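(* For every integer $k\geq2$, the family $p^k\zeta_p(k)$ (indexed by primes $p$) is asymptotically representable.
   Context: For an odd prime $p$, let $\omega:(\mathbb{Z}/p)^\times\to\mathbb{Q}_p^\times$ be the Teichmüller character ($\omega(n)\equiv n\bmod p$), and for a Dirichlet character $\chi$ let $L_p(s,\chi)$ be the Kubota–Leopoldt $p$-adic $L$-function. For $k\geq2$, the $p$-adic zeta value is $\zeta_p(k):=L_p(k,\omega^{1-k})\in\mathbb{Q}_p$. A composition is a finite ordered tuple $\mathbf{s}=(s_1,\ldots,s_m)$ of positive integers (empty allowed), weight $w(\mathbf{s})=\sum s_i$; $H_n(\mathbf{s})=\sum_{n\geq n_1>\cdots>n_m\geq1}n_1^{-s_1}\cdots n_m^{-s_m}$, $H_n(\varnothing)=1$. A collection $a_p\in\mathbb{Z}_p$ (defined for all but finitely many primes $p$) is asymptotically representable if there are coefficients $\alpha_{\mathbf{s}}\in\mathbb{Q}$, one for each composition and independent of $p$, such that for every $n\geq1$ the congruence $a_p\equiv\sum_{w(\mathbf{s})<n}\alpha_{\mathbf{s}}p^{w(\mathbf{s})}H_{p-1}(\mathbf{s})\pmod{p^n}$ holds for all sufficiently large $p$. *)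

(* Defs.v *)
From HB Require Import structures.
From mathcomp Require Import all_boot all_order all_algebra.
From mathcomp Require Import boolp classical_sets.

Set Implicit Arguments.
Unset Strict Implicit.
Unset Printing Implicit Defensive.

Import GRing.Theory Num.Theory.
Local Open Scope ring_scope.

Record prime_number := PrimeNumber { prime_val :> nat; primeP : prime prime_val }.

(* Z_p is the projective limit of the Z/p^n: the component [x n] is the
   representative of [x] mod p^n in [0, p^n), which the single equation
   [x n.+1 %% p ^ n = x n] already enforces. *)
Record padic_int (p : prime_number) := PadicInt {
  padic_res :> nat -> nat;
  padic_coherent : forall n, (padic_res n.+1 %% p ^ n = padic_res n)%N }.

HB.instance Definition _ p := gen_eqMixin (padic_int p).
HB.instance Definition _ p := gen_choiceMixin (padic_int p).

Section PadicInt.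
Local Open Scope nat_scope.
Variable p : prime_number.
Implicit Types x y z : padic_int p.

Lemma padic_int_ext x y : (forall n, x n = y n) -> x = y.
Proof.
case: x y => [x xP] [y yP] /= /funext exy; subst y.
by congr PadicInt; apply: Prop_irrelevance.
Qed.

Lemma padic_res_mod x n : x n %% p ^ n = x n.
Proof. by rewrite -(padic_coherent x n) modn_mod. Qed.

Lemma padic_coherent_le x m n : m <= n -> x n %% p ^ m = x m.
Proof.
elim: n => [|n IHn]; first by rewrite leqn0 => /eqP->; rewrite padic_res_mod.
rewrite leq_eqVlt => /predU1P[->|]; first exact: padic_res_mod.
rewrite ltnS => le_mn; rewrite -[RHS]IHn // -(padic_coherent x n).
by rewrite modn_dvdm // dvdn_exp2l.
Qed.

Fact padic_of_subproof (f : nat -> nat)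
  (fP : forall n, f n.+1 = f n %[mod p ^ n]) n :
  (f n.+1 %% p ^ n.+1) %% p ^ n = f n %% p ^ n.
Proof. by rewrite modn_dvdm ?fP // dvdn_exp2l. Qed.

Definition padic_of f fP : padic_int p :=
  PadicInt (@padic_of_subproof f fP).

Fact padic_const_subproof (c n : nat) : c = c %[mod p ^ n].
Proof. by []. Qed.

Definition padic_const c := padic_of (padic_const_subproof c).

Fact padic_add_subproof x y n : x n.+1 + y n.+1 = x n + y n %[mod p ^ n].
Proof. by rewrite -modnDm !padic_coherent. Qed.

Definition padic_add x y := padic_of (@padic_add_subproof x y).

Fact padic_mul_subproof x y n : x n.+1 * y n.+1 = x n * y n %[mod p ^ n].
Proof. by rewrite -modnMm !padic_coherent. Qed.

Definition padic_mul x y := padic_of (@padic_mul_subproof x y).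

Fact padic_opp_subproof x n :
  p ^ n.+1 - x n.+1 = p ^ n - x n %[mod p ^ n].
Proof.
have pe m : 0 < p ^ m by rewrite expn_gt0 prime_gt0 ?primeP.
have lt m : x m <= p ^ m by rewrite -padic_res_mod ltnW // ltn_mod.
apply/eqP; rewrite -(eqn_modDr (x n.+1)) subnK //.
rewrite -modnDmr padic_coherent subnK // modnn.
by apply/eqP/eqP; rewrite -/(dvdn _ _) dvdn_exp2l.
Qed.

Definition padic_opp x := padic_of (@padic_opp_subproof x).

Fact padic_addA : associative padic_add.
Proof.
by move=> x y z; apply: padic_int_ext => n /=; rewrite modnDmr modnDml addnA.
Qed.

Fact padic_addC : commutative padic_add.
Proof. by move=> x y; apply: padic_int_ext => n /=; rewrite addnC. Qed.

Fact padic_add0 : left_id (padic_const 0) padic_add.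
Proof.
by move=> x; apply: padic_int_ext => n /=; rewrite mod0n add0n padic_res_mod.
Qed.

Fact padic_addN : left_inverse (padic_const 0) padic_opp padic_add.
Proof.
move=> x; apply: padic_int_ext => n /=; rewrite modnDml subnK ?modnn ?mod0n //.
by rewrite -padic_res_mod ltnW // ltn_mod expn_gt0 prime_gt0 ?primeP.
Qed.

HB.instance Definition _ := GRing.isZmodule.Build (padic_int p)
  padic_addA padic_addC padic_add0 padic_addN.

Fact padic_mulA : associative padic_mul.
Proof.
by move=> x y z; apply: padic_int_ext => n /=; rewrite modnMmr modnMml mulnA.
Qed.

Fact padic_mulC : commutative padic_mul.
Proof. by move=> x y; apply: padic_int_ext => n /=; rewrite mulnC. Qed.

Fact padic_mul1 : left_id (padic_const 1) padic_mul.
Proof.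
by move=> x; apply: padic_int_ext => n /=; rewrite modnMml mul1n padic_res_mod.
Qed.

Fact padic_mulDl : left_distributive padic_mul padic_add.
Proof.
move=> x y z; apply: padic_int_ext => n /=.
by rewrite modnMml mulnDl modnDm.
Qed.

Fact padic_one_neq0 : padic_const 1 != padic_const 0.
Proof.
apply/eqP=> /(congr1 (fun x : padic_int p => x 1)) /=.
by rewrite expn1 mod0n modn_small // prime_gt1 ?primeP.
Qed.

HB.instance Definition _ := GRing.Zmodule_isComNzRing.Build (padic_int p)
  padic_mulA padic_mulC padic_mul1 padic_mulDl padic_one_neq0.

Lemma padic_int0E n : (0%R : padic_int p) n = 0.
Proof. exact: mod0n. Qed.

Lemma padic_int1E n : (1%R : padic_int p) n = 1 %% p ^ n.
Proof. by []. Qed.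

Lemma padic_intDE x y n : (x + y)%R n = (x n + y n) %% p ^ n.
Proof. by []. Qed.

Lemma padic_intME x y n : (x * y)%R n = (x n * y n) %% p ^ n.
Proof. by []. Qed.

Lemma padic_natE c n : (c%:R : padic_int p)%R n = c %% p ^ n.
Proof.
elim: c => [|c IHc]; first by rewrite padic_int0E mod0n.
by rewrite -addn1 natrD padic_intDE IHc modnDm.
Qed.

Definition padic_unit : {pred padic_int p} :=
  fun x => `[< exists y : padic_int p, (y * x = 1)%R >].

Definition padic_inv x : padic_int p :=
  if x \in padic_unit then xget x [set y : padic_int p | (y * x = 1)%R] else x.

Fact padic_mulV : {in padic_unit, left_inverse 1%R padic_inv *%R}.
Proof.
move=> x xU; rewrite /padic_inv xU; have /asboolP[y yx] := xU.
by case: xgetP => [z _ //|/(_ y)].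
Qed.

Fact padic_unitP x y : (y * x = 1)%R -> padic_unit x.
Proof. by move=> yx; apply/asboolP; exists y. Qed.

Fact padic_inv_out : {in [predC padic_unit], padic_inv =1 id}.
Proof. by move=> x; rewrite inE /padic_inv => /negPf->. Qed.

HB.instance Definition _ := GRing.ComNzRing_hasMulInverse.Build (padic_int p)
  padic_mulV padic_unitP padic_inv_out.

Lemma padic_int_neq0 x : (x != 0)%R -> exists n, x n != 0.
Proof.
move=> x0; apply: contrapT => nx; case/eqP: x0; apply: padic_int_ext => n.
by rewrite padic_int0E; apply/eqP; apply: contrapT => /negP xn; apply: nx; exists n.
Qed.

Fact padic_int_integral : GRing.integral_domain_axiom (padic_int p).
Proof.
move=> x y xy0; apply/norP => -[/padic_int_neq0[m xm] /padic_int_neq0[n yn]].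
have pp := primeP p; set N := m + n.
have ndv (z : padic_int p) k : k <= N -> z k != 0 ->
    z N > 0 /\ logn p (z N) < k.
  move=> kN zk; rewrite -(padic_coherent_le z kN) in zk.
  have zN : 0 < z N by rewrite lt0n; apply: contraNneq zk => ->; rewrite mod0n.
  by split=> //; rewrite ltnNge -pfactor_dvdn.
have [x0 vx] := ndv x m (leq_addr _ _) xm.
have [y0 vy] := ndv y n (leq_addl _ _) yn.
have : p ^ N %| x N * y N.
  by rewrite /dvdn -padic_intME xy0 padic_int0E.
rewrite pfactor_dvdn ?muln_gt0 ?x0 // lognM // leqNgt.
by rewrite /N -addSn leq_add // ltnW.
Qed.

HB.instance Definition _ := GRing.ComUnitRing_isIntegral.Build (padic_int p)
  padic_int_integral.

End PadicInt.

Notation padic p := {fraction (padic_int p)}.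

Notation "x %:Qp" := (@FracField.tofrac _ x : padic _)
  (at level 2, left associativity, format "x %:Qp").

Definition padic_integral (p : prime_number) (x : padic p) : Prop :=
  exists z : padic_int p, x = z%:Qp.

(* x = y mod p^n Z_p, that is |x - y|_p <= p^(-n) *)
Definition padic_congr (p : prime_number) (n : nat) (x y : padic p) : Prop :=
  exists z : padic_int p, x - y = p%:R ^+ n * z%:Qp.

Record dirichlet (K : fieldType) := Dirichlet {
  dmod : nat;
  dval :> nat -> K;
  dmod_gt0 : (0 < dmod)%N;
  dval_periodic : forall a, dval (a + dmod)%N = dval a;
  dvalM : forall a b, dval (a * b)%N = dval a * dval b;
  dval_neq0 : forall a, (dval a != 0) = coprime a dmod }.

Section Dirichlet.
Variable K : fieldType.
Implicit Types chi psi : dirichlet K.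

Lemma dval_periodicM chi k a : chi (a + k * dmod chi)%N = chi a.
Proof.
elim: k => [|k IHk]; first by rewrite addn0.
by rewrite mulSn (addnC (dmod _)) addnA dval_periodic.
Qed.

Definition dprincipal chi : Prop := forall a, coprime a (dmod chi) -> chi a = 1.

Section Product.
Variables chi psi : dirichlet K.

Let m := lcmn (dmod chi) (dmod psi).
Let f a := chi a * psi a.

Fact dmul_gt0 : (0 < m)%N.
Proof. by rewrite lcmn_gt0 !dmod_gt0. Qed.

Fact dmul_periodic a : f (a + m)%N = f a.
Proof.
rewrite /f; have /dvdnP[k km] := dvdn_lcml (dmod chi) (dmod psi).
rewrite {1}/m km dval_periodicM.
have /dvdnP[l lm] := dvdn_lcmr (dmod chi) (dmod psi).
by rewrite /m lm dval_periodicM.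
Qed.

Fact dmulM a b : f (a * b)%N = f a * f b.
Proof. by rewrite /f !dvalM mulrACA. Qed.

Fact dmul_neq0 a : (f a != 0) = coprime a m.
Proof.
rewrite mulf_eq0 negb_or !dval_neq0; apply/andP/idP => [[c1 c2]|].
  have : coprime a (dmod chi * dmod psi) by rewrite coprimeMr c1.
  by apply: coprime_dvdr; rewrite dvdn_lcm dvdn_mulr // dvdn_mull.
by move=> c; split; apply: coprime_dvdr c; rewrite ?dvdn_lcml ?dvdn_lcmr.
Qed.

Definition dmul : dirichlet K :=
  Dirichlet dmul_gt0 dmul_periodic dmulM dmul_neq0.

End Product.

(* [chi] is induced from the modulus [f] *)
Definition dfactors chi (f : nat) : bool :=
  [forall a : 'I_(dmod chi),
     coprime a (dmod chi) && (a == 1 %[mod f])%N ==> (chi a == 1)].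

Definition conductor chi : nat :=
  head (dmod chi) [seq f <- divisors (dmod chi) | dfactors chi f].

(* The primitive character associated with [chi]: if [a] is prime to the
   conductor [f], its value at [a] is the common value of [chi] at the integers
   congruent to [a] mod f and prime to the modulus; the first such integer
   among a, a + f, a + 2 f, ... is used. *)
Definition dprim chi (a : nat) : K :=
  let f := conductor chi in
  if coprime a f then
    chi (a + f * find (fun j => coprime (a + f * j) (dmod chi))
                      (iota 0 (dmod chi)))%N
  else 0.

End Dirichlet.

Fixpoint bernoulli_seq (n : nat) : seq rat :=
  if n is m.+1 then
    let s := bernoulli_seq m in
    rcons s (((m == 0)%:R - \sum_(j < m) 'C(m.+1, j)%:R * s`_j) / m.+1%:R)
  else [::].

Definition bernoulli (n : nat) : rat := (bernoulli_seq n.+1)`_n.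

Lemma size_bernoulli_seq n : size (bernoulli_seq n) = n.
Proof. by elim: n => //= n IHn; rewrite size_rcons IHn. Qed.

Lemma nth_bernoulli_seq n j : (j < n)%N -> (bernoulli_seq n)`_j = bernoulli j.
Proof.
elim: n => // n IHn; rewrite ltnS leq_eqVlt => /predU1P[-> //|jn].
by rewrite /= nth_rcons size_bernoulli_seq jn IHn.
Qed.

Lemma bernoulli_rec n :
  \sum_(j < n.+1) 'C(n.+1, j)%:R * bernoulli j = (n == 0)%:R.
Proof.
rewrite big_ord_recr /= {2}/bernoulli /= nth_rcons size_bernoulli_seq ltnn eqxx.
rewrite binSn mulrC divfK ?pnatr_eq0 // -[RHS](subrK (\sum_(j < n)
  'C(n.+1, j)%:R * (bernoulli_seq n)`_j)) addrC; congr (_ + _).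
by apply: eq_bigr => j _; rewrite nth_bernoulli_seq.
Qed.

Definition bernoulli_poly (n : nat) : {poly rat} :=
  \sum_(j < n.+1) ('C(n, j)%:R * bernoulli j) *: 'X^(n - j).

(* Coefficient of t^n / n! in
   \sum_(1 <= a <= f) chi(a) t e^(a t) / (e^(f t) - 1), where chi is primitive
   of conductor f, each summand being f^-1 times the generating function of the
   B_n(a / f) at f t. For chi = 1 this gives B_1 = +1/2. *)
Definition gen_bernoulli (K : fieldType) (n : nat) (chi : dirichlet K) : K :=
  let f := conductor chi in
  f%:R ^+ n / f%:R *
  \sum_(1 <= a < f.+1) dprim chi a * ratr (bernoulli_poly n).[a%:R / f%:R].

Section Teichmuller.
Variable p : prime_number.

Lemma modn_exp_prime (k x y : nat) :
  (0 < k -> x = y %[mod p ^ k] -> x ^ p = y ^ p %[mod p ^ k.+1])%N.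
Proof.
move=> k0; wlog le_yx : x y / (y <= x)%N => [IH exy|exy].
  case/orP: (leq_total y x) => le; first exact: (IH x y le exy).
  by apply: esym; apply: (IH y x le); apply: esym.
have exyp : (x = y %[mod p])%N.
  have dp : (p %| p ^ k)%N by rewrite dvdn_exp.
  by rewrite -(modn_dvdm x dp) exy modn_dvdm.
apply/eqP; rewrite eqn_mod_dvd ?leq_exp2r ?prime_gt0 ?primeP //.
rewrite subn_exp expnSr dvdn_mul //; first by rewrite -eqn_mod_dvd //; apply/eqP.
rewrite /dvdn -modn_summ.
rewrite (eq_bigr (fun i => y ^ p.-1 %% p)%N); last first.
  move=> i _; rewrite -modnMml -modnXm exyp modnXm modnMml -expnD.
  by rewrite subnK // -ltnS prednK ?prime_gt0 ?primeP.
by rewrite sum_nat_const card_ord mulnC modnMl.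
Qed.

Lemma modn_exp_primeX (n x y : nat) :
  (x = y %[mod p] -> x ^ (p ^ n) = y ^ (p ^ n) %[mod p ^ n.+1])%N.
Proof.
move=> exy; elim: n => [|n IHn]; first by rewrite !expn1.
by rewrite (expnSr p n) !expnM; apply: modn_exp_prime.
Qed.

Fact teich_subproof (a n : nat) : (a ^ (p ^ n.+1) = a ^ (p ^ n) %[mod p ^ n])%N.
Proof.
have dp : (p ^ n %| p ^ n.+1)%N by rewrite dvdn_exp2l.
rewrite expnS expnM -(modn_dvdm _ dp).
rewrite (@modn_exp_primeX n (a ^ p)%N a) ?modn_dvdm //.
exact/fermat_little/primeP.
Qed.

(* The Teichmueller representative of [a], as the limit of the a^(p^n); it is 0
   when p divides [a]. *)
Definition teich (a : nat) : padic_int p := padic_of (teich_subproof a).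

Lemma teich_modp a : teich a 1 = (a %% p)%N.
Proof. by rewrite /= expn1; apply/fermat_little/primeP. Qed.

Lemma teich_eq_mod a b : (a = b %[mod p])%N -> teich a = teich b.
Proof.
move=> eab; apply: padic_int_ext => n /=.
have dp : (p ^ n %| p ^ n.+1)%N by rewrite dvdn_exp2l.
by rewrite -(modn_dvdm _ dp) (modn_exp_primeX _ eab) modn_dvdm.
Qed.

Lemma teichM a b : teich (a * b)%N = teich a * teich b.
Proof.
by apply: padic_int_ext => n; rewrite padic_intME /= expnMn modnMm.
Qed.

Lemma teich_eq0 a : (teich a == 0) = (p %| a)%N.
Proof.
apply/eqP/idP => [a0|pa].
  by rewrite /dvdn -teich_modp a0 padic_int0E.
have -> : teich a = teich 0 by apply: teich_eq_mod; rewrite mod0n; apply/eqP.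
apply: padic_int_ext => n; rewrite padic_int0E /= exp0n ?mod0n //.
by rewrite expn_gt0 prime_gt0 ?primeP.
Qed.

Section TeichPower.
Variable i : int.

Let f (a : nat) : padic p := if (p %| a)%N then 0 else (teich a)%:Qp ^ i.

Fact teich_power_gt0 : (0 < p)%N. Proof. exact/prime_gt0/primeP. Qed.

Fact teich_power_periodic a : f (a + p)%N = f a.
Proof.
rewrite /f dvdn_addl // (teich_eq_mod (b := a)) //.
by rewrite -modnDmr modnn addn0.
Qed.

Fact teich_powerM a b : f (a * b)%N = f a * f b.
Proof.
rewrite /f Euclid_dvdM ?primeP //.
have [_|_] /= := boolP (p %| a)%N; first by rewrite mul0r.
have [_|_] /= := boolP (p %| b)%N; first by rewrite mulr0.
by rewrite teichM rmorphM expfzMl.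
Qed.

Fact teich_power_neq0 a : (f a != 0) = coprime a p.
Proof.
rewrite coprime_sym prime_coprime ?primeP // /f.
have [_|pa] /= := boolP (p %| a)%N; first by rewrite eqxx.
by rewrite expfz_neq0 // tofrac_eq0 teich_eq0.
Qed.

(* omega^i, as a Dirichlet character mod p (in particular omega^0 vanishes at
   the multiples of p) *)
Definition teich_power : dirichlet (padic p) :=
  Dirichlet teich_power_gt0 teich_power_periodic teich_powerM teich_power_neq0.

End TeichPower.
End Teichmuller.

Section KubotaLeopoldt.
Variables (p : prime_number) (chi : dirichlet (padic p)).

(* The domain of L_p(s, chi): there is a pole at s = 1 when chi is trivial. *)
Definition padic_L_domain : set (padic_int p) :=
  [set s | ~ (dprincipal chi /\ s = 1)].

(* [f] is continuous on the domain above, and for all n >= 1,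
   f(1 - n) = - (1 - psi(p) p^(n-1)) B_(n,psi) / n, where psi is the primitive
   character associated with chi omega^(-n). As the 1 - n are dense in Z_p,
   this determines [f] on the domain; its existence is the theorem of Kubota
   and Leopoldt. *)
Definition is_padic_L (f : padic_int p -> padic p) : Prop :=
  (forall s, padic_L_domain s -> forall M : nat, exists N : nat,
     forall t, padic_L_domain t ->
       padic_congr N s%:Qp t%:Qp -> padic_congr M (f s) (f t)) /\
  (forall n : nat, (0 < n)%N ->
     let psi := dmul chi (teich_power p (- n%:Z)) in
     f (1 - n%:R) =
       - (1 - dprim psi p * p%:R ^+ n.-1) * gen_bernoulli n psi / n%:R).

(* Only meaningful for odd p (the character omega has conductor 4 for p = 2),
   and at the points of [padic_L_domain]. *)
Definition padic_L : padic_int p -> padic p :=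
  xget (fun=> 0) [set f | is_padic_L f].

End KubotaLeopoldt.

Definition padic_zeta (p : prime_number) (k : nat) : padic p :=
  padic_L (teich_power p (1 - k%:Z)) k%:R.

Definition is_composition (s : seq nat) : bool := all (fun i => 0 < i)%N s.

Definition weight (s : seq nat) : nat := sumn s.

(* The index (n_1, ..., n_m) is encoded as a decreasing tuple over 'I_n.+1. *)
Definition mhs (n : nat) (s : seq nat) : rat :=
  \sum_(t : (size s).-tuple 'I_n.+1 |
          sorted gtn (map val t) && all (fun i : 'I_n.+1 => 0 < i)%N t)
    \prod_(i < size s) (tnth t i)%:R ^- nth 0%N s i.

(* A composition of weight < n has fewer than n parts when n > 0, all of them
   < n. *)
Definition compositions_lt (n : nat) : seq (seq nat) :=
  [seq s <- [seq map val (tval t) | m <- iota 0 n, t <- enum {: m.-tuple 'I_n}]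
          | is_composition s & (weight s < n)%N].

Lemma mem_compositions_lt n s :
  (s \in compositions_lt n) = is_composition s && (weight s < n)%N.
Proof.
rewrite mem_filter; apply: andb_idr => /andP[sP sn].
have [ssz sle] : (size s <= weight s)%N /\ all (fun i => i <= weight s)%N s.
  elim: s sP {sn} => //= i s IHs /andP[i0 /IHs[ssz sle]].
  split; first by rewrite /weight /= -add1n leq_add.
  rewrite /weight /= leq_addr; apply: sub_all sle => j js.
  exact: leq_trans js (leq_addl _ _).
have slt : all (fun i => i < n)%N s.
  by apply: sub_all sle => i /leq_ltn_trans; apply.
apply/allpairsPdep; case: n sn slt => // n sn slt.
exists (size s), (map_tuple inord (in_tuple s)); split.
- by rewrite mem_iota /= add0n (leq_ltn_trans ssz).
- by rewrite mem_enum.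
rewrite -map_comp -[LHS]map_id; apply/eq_in_map => i si /=.
by rewrite inordK //; apply: (allP slt).
Qed.

Lemma uniq_compositions_lt n : uniq (compositions_lt n).
Proof.
apply/filter_uniq/allpairs_uniq_dep; first exact: iota_uniq.
  by move=> m _; apply: enum_uniq.
move=> [m t] [m' t'] _ _ /= ett.
have em : m = m' by rewrite -(size_tuple t) -(size_tuple t') -!(size_map val) ett.
by subst m'; congr existT; apply/val_inj/(inj_map val_inj).
Qed.

(* The values of the family at finitely many primes are immaterial, so that a
   family defined for almost all p is given by an arbitrary extension to all
   primes. *)
Definition asymptotically_representable
    (a : forall p : prime_number, padic p) : Prop :=
  (exists N : nat, forall p : prime_number, (N < p)%N -> padic_integral (a p)) /\
  exists alpha : seq nat -> rat,
    forall n : nat, (0 < n)%N ->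
    exists N : nat, forall p : prime_number, (N < p)%N ->
      padic_congr n (a p)
        (\sum_(s <- compositions_lt n)
           ratr (alpha s) * p%:R ^+ weight s * ratr (mhs p.-1 s)).

(* Main.v *)
(** Let chi = omega^(1-k), where omega is the Teichmueller character, and write
    <a> = a / omega(a). By the distribution relation of the Bernoulli
    polynomials, the value at 1 - n prescribed by the interpolation property is,
    whether or not chi omega^(-n) is trivial,
      - 1/(n p) \sum_(0<a<p) chi(a) <a>^n \sum_j C(n, j) B_j (p/a)^j.
    Since \sum_a chi(a) = 0, the denominator n p cancels, and what remains is a
    finite combination of series in the C(n-1, j) with coefficients tending to
    0. It is therefore uniformly continuous in n and extends to Z_p, so that L_p
    exists. Letting n = p^N (p-1) + 1 - k tend to 1 - k gives
      p^k zeta_p(k) =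
        1/(k-1) \sum_j C(1-k, j) B_j p^(j+k-1) H_(p-1)(j+k-1),
    which only involves compositions with one part. *)

From HB Require Import structures.
Require Import Defs.
From mathcomp Require Import all_boot all_order all_algebra.
From mathcomp Require Import boolp classical_sets.
From mathcomp Require Import zify ring.

Set Implicit Arguments.
Unset Strict Implicit.
Unset Printing Implicit Defensive.

Import GRing.Theory Num.Theory.
Local Open Scope ring_scope.

(** * Bernoulli numbers and polynomials: denominators and the distribution relation *)

Section BernoulliNumbers.

(** A crude substitute for von Staudt-Clausen, read off from the recursion: solved for (n+1) B_n, it
    only involves B_j with j < n, whose denominators divide (j+1)! and hence n!. *)
Lemma fact_bernoulli_int n : (n.+1)`!%:R * bernoulli n \is a Num.int.
Proof.
elim/ltn_ind: n => n IHn; have := bernoulli_rec n.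
rewrite big_ord_recr /= binSn => /(canRL (addKr _)) eB.
rewrite factS natrM mulrAC eB mulrC mulrDr mulrN.
apply: rpredD; last by rewrite rpredM ?rpred_nat.
rewrite rpredN mulr_sumr rpred_sum // => j _; rewrite mulrCA rpredM ?rpred_nat //.
have /dvdnP[c ->] : ((j.+1)`! %| n`!)%N.
    rewrite -(bin_fact (ltn_ord j)); apply: dvdn_mull; apply: dvdn_mulr; exact: dvdnn.
by rewrite natrM -mulrA rpredM ?rpred_nat ?IHn.
Qed.

(** The difference of the two values is the left side of the Bernoulli recursion, which vanishes
    from degree 2 on; in degree 1 it equals 1. *)
Lemma bernoulli_poly1 n : (bernoulli_poly n.+2).[1] = (bernoulli_poly n.+2).[0].
Proof.
rewrite /bernoulli_poly !horner_sum [RHS]big_ord_recr [LHS]big_ord_recr /=.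
rewrite !hornerZ !hornerXn subnn expr0n /= expr1n [in RHS]big1 ?add0r; last first.
  by move=> j _; rewrite hornerZ hornerXn expr0n subn_eq0 leqNgt ltn_ord mulr0.
rewrite -[RHS]add0r; congr (_ + _); rewrite -[RHS](bernoulli_rec n.+1).
by apply: eq_bigr => j _; rewrite hornerZ hornerXn expr1n mulr1.
Qed.

Lemma deriv_bernoulli_poly n :
  (bernoulli_poly n.+1)^`() = n.+1%:R *: bernoulli_poly n.
Proof.
rewrite /bernoulli_poly big_ord_recr /= subnn expr0 derivD alg_polyC derivC addr0.
rewrite raddf_sum scaler_sumr; apply: eq_bigr => j _ /=.
have jn : (j <= n)%N by rewrite -ltnS.
rewrite derivZ derivXn subSn //= -scaler_nat !scalerA; congr (_ *: _).
by rewrite mulrAC -natrM mulnC -subSn // -(mul_bin_down n.+1 j) natrM mulrA.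
Qed.

Lemma bernoulli_poly0 : bernoulli_poly 0 = 1.
Proof.
have := bernoulli_rec 0; rewrite /bernoulli_poly !big_ord_recl !big_ord0 /=.
by rewrite !addr0 => ->; rewrite scale1r.
Qed.

Lemma deriv_eq0_const (f : {poly rat}) : f^`() = 0 -> f = (f.[0])%:P.
Proof.
move=> f0; apply/polyP => -[|i]; rewrite coefC /= ?horner_coef0 //.
have /eqP := congr1 (fun g : {poly rat} => g`_i) f0.
by rewrite coef_deriv coef0 mulrn_eq0 /= => /eqP.
Qed.

Lemma bernoulli_poly_mult q n : (0 < q)%N ->
  \sum_(a < q) q%:R ^+ n *: (bernoulli_poly n \Po (q%:R^-1 *: ('X + a%:R%:P)))
    = q%:R *: bernoulli_poly n.
Proof.
move=> q0; have qn0 : q%:R != 0 :> rat by rewrite pnatr_eq0 -lt0n.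
pose E n := \sum_(a < q) q%:R ^+ n *: (bernoulli_poly n \Po (q%:R^-1 *: ('X + a%:R%:P)))
    - q%:R *: bernoulli_poly n.
have dE m : (E m.+1)^`() = m.+1%:R *: E m.
  rewrite /E derivB derivZ deriv_bernoulli_poly scalerBr; congr (_ - _).
    rewrite raddf_sum scaler_sumr; apply: eq_bigr => a _.
    rewrite /= derivZ deriv_comp deriv_bernoulli_poly derivZ derivD derivX derivC addr0.
    rewrite comp_polyZ -scalerAl -scalerAr mulr1 !scalerA; congr (_ *: _).
    by rewrite exprSr; field.
  by rewrite !scalerA mulrC.
suff E0 m : E m = 0 by apply/eqP; rewrite -subr_eq0; apply/eqP/E0.
elim: m => [|m IHm].
  rewrite /E bernoulli_poly0 -[RHS](subrr (q%:R%:A)); congr (_ - _).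
  rewrite (eq_bigr (fun=> 1)) ?sumr_const ?card_ord ?scaler_nat // => a _.
  by rewrite expr0 scale1r comp_polyC.
have := dE m; rewrite IHm scaler0 => /deriv_eq0_const; set c := (E m.+1).[0] => Ec.
suff c0 : c = 0 by rewrite Ec c0.
(* Passing from X = 0 to X = 1 shifts the arguments a/q by one place, so the sums only differ by the
   values of B_(m+2) at the end points 0 and 1, which agree. *)
have E10 : (E m.+2).[1] = (E m.+2).[0].
  rewrite /E !(hornerD, hornerN, hornerZ) bernoulli_poly1; congr (_ - _).
  rewrite !horner_sum.
  under eq_bigr do rewrite hornerZ horner_comp !hornerE -mulrS.
  under [RHS]eq_bigr do rewrite hornerZ horner_comp !hornerE.
  rewrite -!mulr_sumr; congr (_ * _); case: (q) q0 qn0 => // r _ r0.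
  rewrite big_ord_recr big_ord_recl /= mulVf // mulr0 bernoulli_poly1 addrC.
  by congr (_ + _); apply: eq_bigr => i _.
move: (E m.+2) E10 (dE m.+1) => e e10; rewrite Ec => dE2.
have /deriv_eq0_const/(congr1 (fun f => f.[1] - f.[0])) :
    (e - (m.+2%:R * c) *: 'X)^`() = 0.
  by rewrite derivB derivZ derivX dE2 alg_polyC -mul_polyC -polyCM subrr.
rewrite !hornerE e10 subrr addrAC subrr add0r => /eqP.
by rewrite oppr_eq0 mulf_eq0 pnatr_eq0 /= => /eqP.
Qed.

Lemma bernoulli_poly_scale q n a : (0 < q)%N ->
  q%:R ^+ n * (bernoulli_poly n).[a%:R / q%:R] =
  \sum_(j < n.+1) 'C(n, j)%:R * bernoulli j * q%:R ^+ j * a%:R ^+ (n - j).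
Proof.
move=> q0; have qn0 : q%:R != 0 :> rat by rewrite pnatr_eq0 -lt0n.
rewrite horner_sum mulr_sumr; apply: eq_bigr => j _; rewrite hornerZ hornerXn.
have -> : q%:R ^+ n = q%:R ^+ j * q%:R ^+ (n - j) :> rat.
  by rewrite -exprD subnKC // -ltnS.
by rewrite expr_div_n; field; rewrite expf_neq0.
Qed.

(** The distribution relation at X = 1, with the term of argument q/q moved to the right side. For q
    = p the factor 1 - p^n becomes the Euler factor of the trivial character. *)
Lemma bernoulli_poly_mult1 q n : (0 < q)%N ->
  \sum_(1 <= a < q) q%:R ^+ n.+1 * (bernoulli_poly n.+1).[a%:R / q%:R] =
  q%:R * (1 - q%:R ^+ n) * (bernoulli_poly n.+1).[1].
Proof.
move=> q0; have qn0 : q%:R != 0 :> rat by rewrite pnatr_eq0 -lt0n.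
have /(congr1 (fun f : {poly rat} => f.[1])) := bernoulli_poly_mult n.+1 q0.
rewrite hornerZ horner_sum => e; rewrite mulrBr mulr1 mulrBl -e.
rewrite -(big_mkord xpredT (fun a : nat => (q%:R ^+ n.+1 *:
  (bernoulli_poly n.+1 \Po (q%:R^-1 *: ('X + a%:R%:P)))).[1])).
case: q q0 qn0 e => // r _ qn0 e; rewrite big_add1 /= big_nat_recr //=.
rewrite hornerZ horner_comp !(hornerD, hornerZ, hornerX, hornerC) -mulrS mulVf //.
rewrite exprS addrK; apply: eq_big_nat => a _.
by rewrite hornerZ horner_comp !(hornerD, hornerZ, hornerX, hornerC) -mulrS [_^-1 * _]mulrC.
Qed.

End BernoulliNumbers.

(** Legendre's sum telescopes, because p floor(n/p^(m+1)) <= floor(n/p^m); the remainder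
    floor(n/p^m) is kept in the induction to make it close. *)
Lemma logn_fact_le p n : prime p -> (p.-1 * logn p n`! <= n)%N.
Proof.
move=> pp; rewrite logn_fact // big_add1 /= big_mkord.
suff /(_ n) : forall m, (p.-1 * \sum_(i < m) n %/ p ^ i.+1 + n %/ p ^ m <= n)%N.
  by apply: leq_trans; apply: leq_addr.
elim=> [|m IHm]; first by rewrite big_ord0 muln0 expn0 divn1.
apply: leq_trans IHm; rewrite big_ord_recr /= mulnDr -addnA leq_add2l.
rewrite addnC -mulSn prednK ?prime_gt0 // mulnC expnSr divnMA.
exact: leq_trunc_div.
Qed.

(** * Congruences modulo powers of p and p-adic continuity, relative to a subring O of K *)

Section IntegralCongruences.

Variables (K : fieldType) (iota : {rmorphism rat -> K}) (p : nat).
Variable O : subringClosed K.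
Hypothesis p_pr : prime p.
Hypothesis invO : forall c, coprime c p -> (c%:R)^-1 \in (O : {pred K}).

Implicit Types (x y z : K) (h : nat -> K).

Definition pdvd M x : bool := x / p%:R ^+ M \in (O : {pred K}).

Lemma pnat_neq0 n : (n.+1)%:R != 0 :> K.
Proof. by rewrite -(rmorph_nat iota) fmorph_eq0 pnatr_eq0. Qed.

Lemma nat1D_neq0 n : 1 + n%:R != 0 :> K.
Proof. by rewrite -mulrS pnat_neq0. Qed.

Lemma pX_neq0 M : p%:R ^+ M != 0 :> K.
Proof.
by rewrite expf_neq0 // -(ltn_predK (prime_gt0 p_pr)) pnat_neq0.
Qed.
Hint Resolve pX_neq0 : core.

Lemma pdvd_zero x : pdvd 0 x = (x \in (O : {pred K})).
Proof. by rewrite /pdvd expr0 divr1. Qed.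

Lemma pdvd0 M : pdvd M 0.
Proof. by rewrite /pdvd mul0r rpred0. Qed.

Lemma pdvdD M x y : pdvd M x -> pdvd M y -> pdvd M (x + y).
Proof. by rewrite /pdvd mulrDl; apply: rpredD. Qed.

Lemma pdvdN M x : pdvd M (- x) = pdvd M x.
Proof. by rewrite /pdvd mulNr rpredN. Qed.

Lemma pdvdB M x y : pdvd M x -> pdvd M y -> pdvd M (x - y).
Proof. by move=> Mx My; rewrite pdvdD ?pdvdN. Qed.

Lemma pdvd_sum I (r : seq I) (P : pred I) (F : I -> K) M :
  (forall i, P i -> pdvd M (F i)) -> pdvd M (\sum_(i <- r | P i) F i).
Proof. by move=> FM; apply: (big_ind (pdvd M)) => //; [apply: pdvd0|apply: pdvdD]. Qed.

Lemma pdvdM M N x y : pdvd M x -> pdvd N y -> pdvd (M + N) (x * y).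
Proof. by rewrite /pdvd exprD invfM mulrACA; apply: rpredM. Qed.

Lemma pdvdMl M x y : x \in (O : {pred K}) -> pdvd M y -> pdvd M (x * y).
Proof. by rewrite -pdvd_zero => *; rewrite -(add0n M) pdvdM. Qed.

Lemma pdvdMr M x y : y \in (O : {pred K}) -> pdvd M x -> pdvd M (x * y).
Proof. by rewrite mulrC; apply: pdvdMl. Qed.

Lemma pdvd_exp M : pdvd M (p%:R ^+ M).
Proof. by rewrite /pdvd divff ?rpred1. Qed.

Lemma pdvd_le M N x : (M <= N)%N -> pdvd N x -> pdvd M x.
Proof.
move=> /subnKC<-; rewrite /pdvd exprD invfM mulrA => xN.
rewrite -[_ / _](mulfVK (pX_neq0 (N - M))) rpredM ?rpredX ?rpred_nat //.
Qed.

Lemma pdvd_int M x : pdvd M x -> x \in (O : {pred K}).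
Proof. by rewrite -pdvd_zero; apply: pdvd_le. Qed.

Lemma pdvd_nat M c : (p ^ M %| c)%N -> pdvd M c%:R.
Proof.
by case/dvdnP => q ->; rewrite natrM natrX; apply/pdvdMl/pdvd_exp/rpred_nat.
Qed.

(** The part of c prime to p is invertible in O, so division by c only loses v_p(c) powers of p. *)
Lemma pdvd_div M e c x :
  (0 < c)%N -> (logn p c + M <= e)%N -> pdvd e x -> pdvd M (x / c%:R).
Proof.
move=> c0 le_e /(pdvd_le le_e).
have [q pq ec] := pfactor_coprime p_pr c0.
rewrite /pdvd => xO; rewrite ec natrM natrX invfM mulrA.
move: xO; rewrite exprD invfM mulrA => xO.
have -> : x / q%:R / p%:R ^+ logn p c / p%:R ^+ M =
  x / p%:R ^+ logn p c / p%:R ^+ M / q%:R by ring.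
by rewrite rpredM // invO // coprime_sym.
Qed.

Lemma pdvd_unit M c x : coprime c p -> pdvd M (x / c%:R) = pdvd M x.
Proof.
move=> cp; have c0 : c%:R != 0 :> K.
  case: c cp => [|c _]; last exact: pnat_neq0.
  by rewrite /coprime gcd0n => /eqP p1; move: p_pr; rewrite p1.
apply/idP/idP => [|xM]; last by rewrite pdvdMr ?invO.
by move/(pdvdMr (rpred_nat O c)); rewrite divfK.
Qed.

Lemma pdvd_subM M x y z w :
  y \in (O : {pred K}) -> z \in (O : {pred K}) ->
  pdvd M (x - y) -> pdvd M (z - w) -> pdvd M (x * z - y * w).
Proof.
move=> yO zO xy zw; have -> : x * z - y * w = (x - y) * z + y * (z - w) by ring.
by apply: pdvdD; [apply: pdvdMr|apply: pdvdMl].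
Qed.

(** Each p-th power gains one factor p: in z^p - 1 = (z - 1)(1 + z + ... + z^(p-1)) the second
    factor is congruent to p, hence to 0, modulo p. *)
Lemma pdvd_subX_p N x : pdvd 1 (x - 1) -> pdvd N.+1 (x ^+ (p ^ N) - 1).
Proof.
move=> x1; have xO : x \in (O : {pred K}) by rewrite -[x](subrK 1) rpredD ?rpred1 ?(pdvd_int x1).
have X1 z n : pdvd 1 (z - 1) -> z \in (O : {pred K}) -> pdvd 1 (z ^+ n - 1).
  by move=> z1 zO; rewrite subrX1 pdvdMr ?rpred_sum // => i _; rewrite rpredX.
elim: N => [|N IHN]; first by rewrite expn0.
rewrite expnSr exprM subrX1 -addn1; apply: pdvdM => //.
set z := x ^+ _; have -> : \sum_(i < p) z ^+ i = \sum_(i < p) (z ^+ i - 1) + p%:R ^+ 1.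
  by rewrite big_split /= sumrN sumr_const card_ord expr1 subrK.
by rewrite pdvdD ?pdvd_exp // pdvd_sum // => i _; rewrite X1 ?X1 ?rpredX.
Qed.

(* O stands for Z_p, and h is to be extended from nat to Z_p by uniform
   continuity. *)
Definition padic_cont h : Prop :=
  (forall n, h n \in (O : {pred K})) /\
  forall M, exists N, forall n m, (n = m %[mod p ^ N])%N -> pdvd M (h n - h m).

Lemma padic_cont_const x : x \in (O : {pred K}) -> padic_cont (fun=> x).
Proof. by move=> xO; split=> // M; exists 0%N => n m _; rewrite subrr pdvd0. Qed.

Lemma padic_contD h1 h2 :
  padic_cont h1 -> padic_cont h2 -> padic_cont (fun n => h1 n + h2 n).
Proof.
move=> [h1O h1c] [h2O h2c]; split=> [n|M]; first by rewrite rpredD.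
have [[N1 N1P] [N2 N2P]] := (h1c M, h2c M); exists (maxn N1 N2) => n m nm.
have nmi N : (N <= maxn N1 N2)%N -> (n = m %[mod p ^ N])%N.
  by move=> le; rewrite -(modn_dvdm n (dvdn_exp2l p le)) nm modn_dvdm // dvdn_exp2l.
rewrite opprD addrACA pdvdD ?N1P ?N2P // nmi ?leq_maxl ?leq_maxr //.
Qed.

Lemma padic_contM h1 h2 :
  padic_cont h1 -> padic_cont h2 -> padic_cont (fun n => h1 n * h2 n).
Proof.
move=> [h1O h1c] [h2O h2c]; split=> [n|M]; first by rewrite rpredM.
have [[N1 N1P] [N2 N2P]] := (h1c M, h2c M); exists (maxn N1 N2) => n m nm.
have nmi N : (N <= maxn N1 N2)%N -> (n = m %[mod p ^ N])%N.
  by move=> le; rewrite -(modn_dvdm n (dvdn_exp2l p le)) nm modn_dvdm // dvdn_exp2l.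
rewrite pdvd_subM ?N1P ?N2P // nmi ?leq_maxl ?leq_maxr //.
Qed.

Lemma padic_contN h : padic_cont h -> padic_cont (fun n => - h n).
Proof.
move=> [hO hc]; split=> [n|M]; first by rewrite rpredN.
by have [N NP] := hc M; exists N => n m nm; rewrite -opprD pdvdN NP.
Qed.

Lemma padic_cont_sum I (r : seq I) (P : pred I) (F : I -> nat -> K) :
  (forall i, P i -> padic_cont (F i)) ->
  padic_cont (fun n => \sum_(i <- r | P i) F i n).
Proof.
move=> Fc; elim: r => [|i r IHr].
  have := padic_cont_const (rpred0 O); congr padic_cont.
  by apply: funext => n; rewrite big_nil.
case: (boolP (P i)) => [Pi|/negPf Pi].
  have := padic_contD (Fc i Pi) IHr; congr padic_cont.
  by apply: funext => n; rewrite big_cons Pi.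
by move: IHr; congr padic_cont; apply: funext => n; rewrite big_cons Pi.
Qed.

Lemma padic_cont_nat : padic_cont (fun n => n%:R).
Proof.
split=> [n|M]; first exact: rpred_nat.
exists M => n m; wlog le_mn : n m / (m <= n)%N => [IH nm|nm].
  case/orP: (leq_total m n) => [/IH|/IH]; first exact.
  by rewrite -pdvdN opprB; apply.
by rewrite -natrB // pdvd_nat // -eqn_mod_dvd //; apply/eqP.
Qed.

Lemma padic_cont_shift h : padic_cont h -> padic_cont (fun n => h n.+1).
Proof.
move=> [hO hc]; split=> // M; have [N NP] := hc M; exists N => n m nm.
by apply: NP; rewrite -addn1 -modnDml nm modnDml addn1.
Qed.

Lemma natr_ffact n j : (n ^_ j)%:R = \prod_(i < j) (n%:R - i%:R) :> K.
Proof.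
elim: j => [|j IHj]; first by rewrite ffactn0 big_ord0.
rewrite big_ord_recr /= -IHj ffactnSr natrM.
have [jn|nj] := leqP j n; first by rewrite natrB.
by rewrite ffact_small // !mul0r.
Qed.

(** The falling factorial is a polynomial in n with integer coefficients, hence continuous; asking
    it for v_p(j!) additional powers of p pays for the division by j!. *)
Lemma padic_cont_bin j : padic_cont (fun n => 'C(n, j)%:R).
Proof.
split=> [n|M]; first exact: rpred_nat.
have : padic_cont (fun n => (n ^_ j)%:R).
  elim: j => [|j IHj].
    by have := padic_cont_const (rpred1 O); congr padic_cont; apply: funext.
  have := padic_contM IHj (padic_contD padic_cont_nat
    (padic_contN (padic_cont_const (rpred_nat O j)))).
  congr padic_cont; apply: funext => n.
  by rewrite !natr_ffact big_ord_recr.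
case=> _ /(_ (logn p j`! + M)%N)[N NP]; exists N => n m /NP.
have j0 : (j`!)%:R != 0 :> K by rewrite -(ltn_predK (fact_gt0 j)) pnat_neq0.
move/(pdvd_div (fact_gt0 j) (leqnn _)).
by rewrite -!bin_ffact !natrM -mulrBl mulfK.
Qed.

(** A Mahler series. Modulo p^M only the finitely many terms with j < 2M survive, and each of them
    is continuous. The bound j <= n on the sum is harmless since C(n, j) = 0 beyond it, so both sums
    can be brought to a common range. *)
Lemma padic_cont_mahler (c : nat -> K) :
  (forall j, pdvd (j - j./2) (c j)) ->
  padic_cont (fun n => \sum_(j < n.+1) 'C(n, j)%:R * c j).
Proof.
move=> cP; have cO j : c j \in (O : {pred K}) by exact: pdvd_int (cP j).
split=> [n|M]; first by rewrite rpred_sum // => j _; rewrite rpredM ?rpred_nat.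
have := @padic_cont_sum _ (index_enum 'I_(M.*2)) xpredT (fun j n => 'C(n, j)%:R * c j)
  (fun j _ => padic_contM (padic_cont_bin j) (padic_cont_const (cO j))).
case=> _ /(_ M)[N NP]; exists N => n m /NP.
have trunc r : pdvd M (\sum_(j < r.+1) 'C(r, j)%:R * c j
    - \sum_(j < M.*2) 'C(r, j)%:R * c j).
  rewrite -(big_mkord xpredT (fun j => 'C(r, j)%:R * c j)).
  rewrite -(big_mkord xpredT (fun j => 'C(r, j)%:R * c j)).
  rewrite (@big_nat_widen _ _ _ 0 r.+1 (maxn r.+1 M.*2)) ?leq_maxl //.
  rewrite (@big_nat_widen _ _ _ 0 M.*2 (maxn r.+1 M.*2)) ?leq_maxr //.
  rewrite !(big_mkcond (fun i => _ && _)) -sumrB; apply: pdvd_sum => j _ /=.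
  case: ltnP => jr; case: ltnP => jM; rewrite ?subrr ?subr0 ?pdvd0 //.
    by apply/pdvdMl; rewrite ?rpred_nat // (pdvd_le _ (cP j)) //; lia.
  by rewrite bin_small // mul0r subrr pdvd0.
move=> nm; have := pdvdB (pdvdD (trunc n) nm) (trunc m); congr pdvd; ring.
Qed.

(** If n - m = q p^M, the quotient of the two powers is a power of x^(p^M), which [pdvd_subX_p]
    controls. *)
Lemma padic_cont_exp x : pdvd 1 (x - 1) -> padic_cont (fun n => x ^+ n).
Proof.
move=> x1; have xO : x \in (O : {pred K}) by rewrite -[x](subrK 1) rpredD ?rpred1 ?(pdvd_int x1).
split=> [n|M]; first by rewrite rpredX.
exists M => n m; wlog le_mn : n m / (m <= n)%N => [IH nm|/eqP].
  case/orP: (leq_total m n) => [/IH|/IH]; first exact.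
  by rewrite -pdvdN opprB; apply.
rewrite eqn_mod_dvd // => /dvdnP[q nm]; rewrite -(subnK le_mn) nm exprD mulrC.
rewrite -[X in _ - X]mulr1 -mulrBr pdvdMl ?rpredX // mulnC exprM subrX1.
rewrite pdvdMr ?rpred_sum // => [i _|]; first by rewrite !rpredX.
exact/(pdvd_le (leqnSn M))/pdvd_subX_p.
Qed.

Lemma bernoulli_iota_int n : (n.+1`!)%:R * iota (bernoulli n) \in (O : {pred K}).
Proof.
have /Num.Theory.intrP[z] := fact_bernoulli_int n.
move/(congr1 iota); rewrite rmorphM rmorph_nat /= => ->.
by rewrite rmorph_int rpred_int.
Qed.

Lemma coprime_fact n : (n < p)%N -> coprime n`! p.
Proof.
move=> np; rewrite coprime_sym prime_coprime //; apply/negP.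
elim: n np => [|n IHn] np; first by rewrite fact0 dvdn1 => /eqP p1; move: p_pr; rewrite p1.
rewrite factS Euclid_dvdM // => /orP[/dvdn_leq|]; first by move/(_ isT); rewrite leqNgt np.
exact/IHn/ltnW.
Qed.

Lemma bernoulli_int n : (n.+1 < p)%N -> iota (bernoulli n) \in (O : {pred K}).
Proof.
move=> np; have := bernoulli_iota_int n; rewrite -!pdvd_zero.
rewrite -(pdvd_unit _ _ (coprime_fact np)) mulrAC divff ?mul1r //.
by rewrite -(ltn_predK (fact_gt0 _)) pnat_neq0.
Qed.

(** Controls the tail of the expansion of the zeta value. If j + 1 < p then B_j is p-integral.
    Otherwise p <= j + 1 <= e, so M <= e/2, while by Legendre's bound the denominator (j+1)! has
    valuation at most e/6. *)
Lemma pdvd_bernoulli M e j :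
  (7 <= p)%N -> (M.*2 <= p)%N -> (M <= e)%N -> (j < e)%N ->
  pdvd M (p%:R ^+ e * iota (bernoulli j)).
Proof.
move=> p7 pM Me je; have [jp|pj] := ltnP j.+1 p.
  by rewrite pdvdMr ?bernoulli_int // (pdvd_le Me) ?pdvd_exp.
have j0 : ((j.+1)`!)%:R != 0 :> K by rewrite -(ltn_predK (fact_gt0 _)) pnat_neq0.
rewrite -(mulKf j0 (iota _)) mulrCA mulrC; apply: (@pdvd_div _ e).
- exact: fact_gt0.
- by have := logn_fact_le j.+1 p_pr; nia.
- by rewrite pdvdMr ?bernoulli_iota_int ?pdvd_exp.
Qed.

Lemma bernoulli0 : bernoulli 0 = 1.
Proof. by have := bernoulli_rec 0; rewrite big_ord1 mul1r. Qed.

(** * Continuity in n of the prescribed values of the L-function *)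

Section Interpolation.

Hypothesis p7 : (7 <= p)%N.

(** Provides the decay required by [padic_cont_mahler]. The factor (j+2)! is the denominator allowed
    for B_(j+1). As p - 1 >= 6, Legendre's bound keeps v_p(j+1) + v_p((j+2)!) within j/2. *)
Lemma pdvd_mahler_coef j y :
  (j.+2)`!%:R * y \in (O : {pred K}) ->
  pdvd (j - j./2) (p%:R ^+ j / j.+1%:R * y).
Proof.
move=> yO; have j2 : ((j.+2)`!)%:R != 0 :> K.
  by rewrite -(ltn_predK (fact_gt0 _)) pnat_neq0.
have -> : p%:R ^+ j / j.+1%:R * y =
    p%:R ^+ j * ((j.+2)`!%:R * y) / (j.+1 * (j.+2)`!)%:R.
  by rewrite natrM; field; rewrite j2 nat1D_neq0.
have f1 := fact_gt0 j.+2.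
have c0 : (0 < j.+1 * (j.+2)`!)%N by rewrite muln_gt0 f1.
apply: (@pdvd_div _ j) => //; last by rewrite pdvdMr ?pdvd_exp.
have := logn_fact_le j.+2 p_pr; have := logn_fact_le j.+1 p_pr.
have -> : logn p (j.+1)`! = (logn p j.+1 + logn p j`!)%N by rewrite -lognM ?fact_gt0.
have -> : logn p (j.+1 * (j.+2)`!) = (logn p j.+1 + logn p (j.+2)`!)%N by rewrite lognM.
move: (logn p j.+1) (logn p j`!) (logn p j.+2`!) => x y' z.
have [q ->] : exists q, p = (q + 7)%N by exists (p - 7)%N; lia.
rewrite addnS /=; nia.
Qed.

(** The identity (m+1) C(m, j) = (j+1) C(m+1, j+1) absorbs the denominator m + 1, so that the
    coefficients of the C(m, j) no longer depend on m. *)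
Lemma powB1_mahler m u :
  ((1 + p%:R * u) ^+ m.+1 - 1) / (m.+1%:R * p%:R) =
  \sum_(j < m.+1) 'C(m, j)%:R * (p%:R ^+ j / j.+1%:R * u ^+ j.+1) :> K.
Proof.
have p0 := pX_neq0 1; rewrite expr1 in p0.
rewrite exprDn big_ord_recl /= bin0 expr1n mul1r mulr1n addrAC subrr add0r.
rewrite mulr_suml; apply: eq_bigr => j _; rewrite expr1n mul1r exprMn.
rewrite -mulr_natl /bump /= add1n.
have jE : m.+1%:R * 'C(m, j)%:R = j.+1%:R * 'C(m.+1, j.+1)%:R :> K.
  by rewrite -!natrM mul_bin_diag.
rewrite -[X in X * _ / _](mulKf (pnat_neq0 j)) -jE exprS.
by field; rewrite p0 !nat1D_neq0.
Qed.

(** The same absorption of m + 1; only the term of B_0 keeps the denominator (m+1) p. *)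
Lemma bernoulli_mahler m A : A != 0 ->
  (\sum_(j < m.+2) 'C(m.+1, j)%:R * iota (bernoulli j) * p%:R ^+ j * A ^+ (m.+1 - j))
     / (m.+1%:R * p%:R) =
  A ^+ m.+1 * (1 / (m.+1%:R * p%:R) + \sum_(j < m.+1) 'C(m, j)%:R *
     (p%:R ^+ j / j.+1%:R * (iota (bernoulli j.+1) * A^-1 ^+ j.+1))).
Proof.
move=> A0; have p0 := pX_neq0 1; rewrite expr1 in p0.
rewrite big_ord_recl /= bin0 bernoulli0 (rmorph1 iota) expr0 !mulr1 !mul1r subn0.
rewrite [LHS]mulrDl [RHS]mulrDr.
congr (_ + _); rewrite mulr_suml mulr_sumr; apply: eq_bigr => j _.
rewrite /bump /= add1n subSS.
have jE : m.+1%:R * 'C(m, j)%:R = j.+1%:R * 'C(m.+1, j.+1)%:R :> K.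
  by rewrite -!natrM mul_bin_diag.
rewrite -[X in X * _ * _ * _ / _](mulKf (pnat_neq0 j)) -jE exprS.
have -> : A ^+ m.+1 * ('C(m, j)%:R * (p%:R ^+ j / j.+1%:R *
   (iota (bernoulli j.+1) * A^-1 ^+ j.+1))) = A ^+ (m - j) *
   ('C(m, j)%:R * (p%:R ^+ j / j.+1%:R * iota (bernoulli j.+1))).
  have -> : A ^+ m.+1 = A ^+ (m - j) * A ^+ j.+1.
    by rewrite -exprD addnS subnK // -ltnS.
  by rewrite exprVn; field; rewrite expf_neq0 // nat1D_neq0.
by field; rewrite p0 !nat1D_neq0.
Qed.

Variables (chi omega : nat -> K).
Hypothesis chiO : forall a, (0 < a < p)%N -> chi a \in (O : {pred K}).
Hypothesis chi_sum0 : \sum_(1 <= a < p) chi a = 0.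
Hypothesis omega_neq0 : forall a, (0 < a < p)%N -> omega a != 0.
Hypothesis omega_modp : forall a, (0 < a < p)%N -> pdvd 1 (a%:R / omega a - 1).

(* The value at 1 - n of the p-adic L-function of chi. *)
Definition padic_L_val n : K :=
  - ((\sum_(1 <= a < p) chi a * omega a ^- n *
        \sum_(j < n.+1) 'C(n, j)%:R * iota (bernoulli j) * p%:R ^+ j * a%:R ^+ (n - j))
     / (n%:R * p%:R)).

(** With t = a / omega(a), the term of B_0 contributes t^(m+1) / ((m+1) p), which need not be
    integral. As the chi(a) sum to 0, it may be replaced by (t^(m+1) - 1) / ((m+1) p), and t = 1 mod
    p makes this a Mahler series by [powB1_mahler]. *)
Lemma padic_L_val_cont : padic_cont (fun m => padic_L_val m.+1).
Proof.
have p0 := pX_neq0 1; rewrite expr1 in p0.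
pose u a := (a%:R / omega a - 1) / p%:R.
pose t a := a%:R / omega a.
have tE a : t a = 1 + p%:R * u a by rewrite /u mulrC divfK // addrC subrK.
pose h a m := chi a *
 (\sum_(j < m.+1) 'C(m, j)%:R * (p%:R ^+ j / j.+1%:R * u a ^+ j.+1) +
  t a ^+ m.+1 * \sum_(j < m.+1) 'C(m, j)%:R *
     (p%:R ^+ j / j.+1%:R * (iota (bernoulli j.+1) * (a%:R)^-1 ^+ j.+1))).
have a_neq0 a : (0 < a < p)%N -> a%:R != 0 :> K.
  by case: a => // a _; apply: pnat_neq0.
have -> : (fun m => padic_L_val m.+1) = (fun m => - \sum_(1 <= a < p) h a m).
  apply: funext => m; rewrite /padic_L_val; congr (- _).
  (* The vanishing sum of the chi(a), divided by (m+1) p, is added to the right side to compensate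
     the -1 of [powB1_mahler] term by term. *)
  rewrite -[RHS]addr0 -[X in _ = _ + X](mulr0 (m.+1%:R * p%:R)^-1).
  rewrite -[X in _ = _ + _ * X]chi_sum0 [in RHS]mulr_sumr -[RHS]big_split /= mulr_suml.
  rewrite !big_nat; apply: eq_bigr => a ap /=.
  rewrite -mulrA bernoulli_mahler ?a_neq0 // /h -powB1_mahler -tE.
  rewrite /t expr_div_n; move: (\sum_(j < _) _) => s.
  by field; rewrite expf_neq0 ?omega_neq0 // p0 nat1D_neq0.
apply: padic_contN.
rewrite (_ : (fun=> _) = (fun m => \sum_(1 <= a < p | (0 < a < p)%N) h a m)); last first.
  by apply: funext => m; rewrite big_nat.
apply: padic_cont_sum => a ap; apply: padic_contM; first exact: padic_cont_const (chiO ap).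
have uO : u a \in (O : {pred K}) by have := omega_modp ap; rewrite /pdvd expr1.
have ac : coprime a p.
  by rewrite coprime_sym prime_coprime // gtnNdvd //; case/andP: ap.
apply: padic_contD.
  apply: (@padic_cont_mahler (fun j => p%:R ^+ j / j.+1%:R * u a ^+ j.+1)) => j.
  by apply: pdvd_mahler_coef; rewrite rpredM ?rpred_nat ?rpredX.
apply: padic_contM; first exact/(@padic_cont_shift (fun m => t a ^+ m))/padic_cont_exp/omega_modp.
apply: (@padic_cont_mahler (fun j =>
  p%:R ^+ j / j.+1%:R * (iota (bernoulli j.+1) * (a%:R)^-1 ^+ j.+1))) => j.
by apply: pdvd_mahler_coef; rewrite mulrA rpredM ?bernoulli_iota_int // rpredX // invO.
Qed.

End Interpolation.

(* C(-k, m - k) B_(m - k) / k, the coefficient of p^m H_(p-1)(m) in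
   p^(k+1) zeta_p(k+1), for m >= k: the index is shifted by one. *)
Definition zeta_coef k m : rat :=
  \prod_(i < m - k) (- k%:R - i%:R) / ((m - k)`! * k)%:R * bernoulli (m - k).

Lemma pdvd_prod_sub M x y j :
  x \in (O : {pred K}) -> y \in (O : {pred K}) -> pdvd M (x - y) ->
  pdvd M (\prod_(i < j) (x - i%:R) - \prod_(i < j) (y - i%:R)).
Proof.
move=> xO yO xy; elim: j => [|j IHj]; first by rewrite !big_ord0 subrr pdvd0.
rewrite !big_ord_recr /= pdvd_subM ?rpred_prod ?rpredB ?rpred_nat //.
- by move=> i _; rewrite rpredB ?rpred_nat.
- by rewrite opprB addrA subrK.
Qed.

(** Here n plays the role of -k: as n + k = (p-1) p^N, it is congruent to -k modulo p^N, which turns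
    C(n, j)/n into -C(-k, j)/k, and a^(n+k) = 1 mod p^(N+1) turns a^(n-j) into a^(-(k+j)). *)
Lemma zeta_approx k M N n :
  (0 < k)%N -> (7 + k + M.*2 <= p)%N -> (k + M < N)%N -> (n + k = p.-1 * p ^ N)%N ->
  (forall a, (0 < a < p)%N -> pdvd 1 (a%:R ^+ p.-1 - 1)) ->
  pdvd M
   (p%:R ^+ k.+1 * - ((\sum_(1 <= a < p)
      \sum_(j < n.+1) 'C(n, j)%:R * iota (bernoulli j) * p%:R ^+ j * a%:R ^+ (n - j))
     / (n%:R * p%:R))
    - \sum_(k <= m < M) iota (zeta_coef k m) * p%:R ^+ m * \sum_(1 <= a < p) a%:R ^- m).
Proof.
move=> k0 pkM kMN nk fermat.
have p0 := pX_neq0 1; rewrite expr1 in p0.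
have NpN : (N < p ^ N)%N by rewrite ltn_expl //; lia.
have nM : (M < n)%N by nia.
have n0 : n%:R != 0 :> K by rewrite -(ltn_predK nM) pnat_neq0.
have k_neq0 : k%:R != 0 :> K by rewrite -(ltn_predK k0) pnat_neq0.
have nkM : pdvd M (n%:R - - k%:R).
  rewrite opprK -natrD nk pdvd_nat // dvdn_mull // dvdn_exp2l //; lia.
have kp : coprime k p.
  by rewrite coprime_sym prime_coprime // gtnNdvd //; lia.
have np : coprime n p.
  rewrite coprime_sym prime_coprime //; apply/negP => pn.
  have : (p %| n + k)%N by rewrite nk dvdn_mull // dvdn_exp //; lia.
  by rewrite dvdn_addr // gtnNdvd //; lia.
have aO a m : (0 < a < p)%N -> (a%:R ^- m) \in (O : {pred K}).
  move=> ap; rewrite -exprVn rpredX // invO //.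
  by rewrite coprime_sym prime_coprime // gtnNdvd //; case/andP: ap.
(* The j-th term of the expansion; the sum is then indexed by the exponent m = j + k of p. *)
pose T j := - ('C(n, j)%:R * iota (bernoulli j) * p%:R ^+ (j + k)
  * (\sum_(1 <= a < p) a%:R ^+ (n - j)) / n%:R) : K.
have -> : p%:R ^+ k.+1 * - ((\sum_(1 <= a < p)
      \sum_(j < n.+1) 'C(n, j)%:R * iota (bernoulli j) * p%:R ^+ j * a%:R ^+ (n - j))
     / (n%:R * p%:R)) = \sum_(k <= m < n.+1 + k) T (m - k)%N.
  rewrite -[X in _ = \sum_(X <= _ < _) _]add0n big_addn addnK big_mkord exchange_big /=.
  rewrite mulrN mulr_suml mulr_sumr.
  rewrite -sumrN; apply: eq_bigr => j _; rewrite /T addnK -mulr_sumr; congr (- _).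
  by rewrite exprS exprD; move: (\sum_(_ <= _ < _) _) => s; field; rewrite p0 n0.
rewrite (@big_nat_widen _ _ _ k M (n.+1 + k)); last by lia.
rewrite [X in _ - X]big_mkcond -sumrB big_nat; apply: pdvd_sum => m /andP[km mn] /=.
have mE : (m - k + k = m)%N by rewrite subnK.
(* For m >= M there is nothing to subtract, and p^m B_(m-k) is already divisible by p^M. *)
case: ifP => [mM|/negbT mM]; last first.
  rewrite subr0 /T pdvdN pdvd_unit // mE.
  rewrite -mulrA -mulrA; apply: pdvdMl; first exact: rpred_nat.
  rewrite mulrA [iota _ * _]mulrC; apply: pdvdMr.
    by rewrite rpred_sum // => a _; rewrite rpredX ?rpred_nat.
  by apply: pdvd_bernoulli; lia.
rewrite /T /zeta_coef mE; set j := (m - k)%N.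
have jf : (j`!)%:R != 0 :> K by rewrite -(ltn_predK (fact_gt0 _)) pnat_neq0.
have CE : 'C(n, j)%:R = \prod_(i < j) (n%:R - i%:R) / (j`!)%:R :> K.
  by rewrite -natr_ffact -bin_ffact natrM mulfK.
have -> : iota (\prod_(i < j) (- k%:R - i%:R) / (j`! * k)%:R * bernoulli j) =
    \prod_(i < j) (- k%:R - i%:R) / (j`! * k)%:R * iota (bernoulli j).
  rewrite !rmorphM /= fmorphV rmorphM /= !rmorph_nat -natrM rmorph_prod; congr (_ / _ * _).
  by apply: eq_bigr => i _; rewrite rmorphB rmorphN !rmorph_nat.
rewrite CE natrM; set P1 := \prod_(i < j) _; set P2 := \prod_(i < j) _.
set S1 := \sum_(_ <= _ < _) _; set S2 := \sum_(_ <= _ < _) _.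
(* The common factor is p-integral because j < M keeps j + 1 below p; what remains is a congruence
   between two products. *)
have -> : - (P1 / j`!%:R * iota (bernoulli j) * p%:R ^+ m * S1 / n%:R) -
    P2 / (j`!%:R * k%:R) * iota (bernoulli j) * p%:R ^+ m * S2 =
  (p%:R ^+ m * iota (bernoulli j) / j`!%:R) * ((- P1 / n%:R) * S1 - (P2 / k%:R) * S2).
  by field; rewrite jf n0 k_neq0.
have PO x : x \in (O : {pred K}) -> \prod_(i < j) (x - i%:R) \in (O : {pred K}).
  by move=> xO; rewrite rpred_prod // => i _; rewrite rpredB ?rpred_nat.
apply: pdvdMl.
  rewrite rpredM ?invO ?coprime_fact // ?rpredM ?rpredX ?rpred_nat ?bernoulli_int //; lia.
have P12 : pdvd M (P1 - P2) by apply: pdvd_prod_sub; rewrite ?rpredN ?rpred_nat.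
apply: pdvd_subM.
- by rewrite rpredM ?invO // PO // rpredN rpred_nat.
- by rewrite rpred_sum // => a _; rewrite rpredX ?rpred_nat.
- have -> : - P1 / n%:R - P2 / k%:R =
      - ((P1 - P2) * k%:R + (n%:R - - k%:R) * P2) / k%:R / n%:R.
    by field; rewrite n0 k_neq0.
  rewrite !pdvd_unit // pdvdN; apply: pdvdD; first by rewrite pdvdMr ?rpred_nat.
  by rewrite pdvdMr // PO // rpredN rpred_nat.
rewrite -sumrB big_nat; apply: pdvd_sum => a ap.
have a0 : a%:R != 0 :> K by case: (a) ap => // a' _; apply: pnat_neq0.
have -> : a%:R ^+ (n - j) - a%:R ^- m = a%:R ^- m * (a%:R ^+ (n + k) - 1) :> K.
  have -> : (n + k = n - j + m)%N by rewrite /j; lia.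
  by rewrite exprD; field; rewrite expf_neq0.
apply: pdvdMl; first exact: aO.
rewrite nk exprM; apply: (@pdvd_le _ N.+1); first by lia.
exact/pdvd_subX_p/fermat.
Qed.

End IntegralCongruences.

(** * The embedding of the rationals in a field of characteristic 0 *)

Section RatrChar0.
Variable F : fieldType.
Hypothesis char0 : forall n, n.+1%:R != 0 :> F.

Lemma char0_intr_eq0 (m : int) : (m%:~R == 0 :> F) = (m == 0).
Proof.
case: m => [[|n]|n]; first by rewrite mulr0z !eqxx.
  exact: (negbTE (char0 n)).
by rewrite NegzE mulrNz !oppr_eq0; exact: (negbTE (char0 n)).
Qed.

(** [ratr] is defined through the reduced fraction; by cross-multiplication in the integers any
    other fraction gives the same value. Additivity and multiplicativity follow from this. *)
Lemma char0_ratrE (m d : int) : d != 0 -> ratr (m%:~R / d%:~R) = m%:~R / d%:~R :> F.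
Proof.
move=> d0; set x : rat := _ / _; have d0' : d%:~R != 0 :> rat by rewrite intr_eq0.
rewrite /ratr; apply/eqP; rewrite eqr_div ?char0_intr_eq0 ?denq_neq0 //.
rewrite -!intrM; apply/eqP; congr _%:~R; apply/eqP.
rewrite -(eqr_int rat) !intrM; apply/eqP.
by rewrite numqE /x mulrAC divfK.
Qed.

Lemma char0_ratr_zmod : zmod_morphism (@ratr F).
Proof.
move=> x y; have [dx dy] := (denq_neq0 x, denq_neq0 y).
have -> : x - y =
    (numq x * denq y - numq y * denq x)%:~R / (denq x * denq y)%:~R.
  rewrite rmorphB !rmorphM /= -{1}(divq_num_den x) -{1}(divq_num_den y).
  by field; rewrite !intr_eq0 dx dy.
rewrite char0_ratrE ?mulf_neq0 // rmorphB !rmorphM /= /ratr.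
by field; rewrite !char0_intr_eq0 dx dy.
Qed.

Lemma char0_ratr_monoid : monoid_morphism (@ratr F).
Proof.
split=> [|x y]; first by rewrite /ratr divr1.
have [dx dy] := (denq_neq0 x, denq_neq0 y).
have -> : x * y = (numq x * numq y)%:~R / (denq x * denq y)%:~R.
  rewrite !rmorphM /= -{1}(divq_num_den x) -{1}(divq_num_den y).
  by field; rewrite !intr_eq0 dx dy.
rewrite char0_ratrE ?mulf_neq0 // !rmorphM /= /ratr.
by field; rewrite !char0_intr_eq0 dx dy.
Qed.

End RatrChar0.

(** * Q_p: divisibility, completeness and extension by continuity *)

Section PadicNumbers.
Variable p : prime_number.
Local Notation K := (padic p).
Implicit Types (t u v z : padic_int p).

Let p_pr : prime p := Defs.primeP p.

Lemma padic_char0 n : n.+1%:R != 0 :> K.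
Proof.
rewrite -(rmorph_nat (@FracField.tofrac (padic_int p))) tofrac_eq0.
apply/eqP => /(congr1 (fun z : padic_int p => z n.+1)).
rewrite padic_natE padic_int0E modn_small //.
by rewrite ltn_expl // prime_gt1.
Qed.

(** A name for [ratr] with values in Q_p, to which the ring morphism structure is attached. *)
Definition qp_of_rat : rat -> K := ratr.
HB.instance Definition _ := GRing.isZmodMorphism.Build rat K qp_of_rat
  (char0_ratr_zmod padic_char0).
HB.instance Definition _ := GRing.isMonoidMorphism.Build rat K qp_of_rat
  (char0_ratr_monoid padic_char0).

Definition zp : {pred K} := fun x => `[< padic_integral x >].

Lemma zpP x : reflect (padic_integral x) (x \in zp).
Proof. exact: asboolP. Qed.

Fact zp_subring : subring_closed zp.
Proof.
split=> [|x y /zpP[u ->] /zpP[v ->]|x y /zpP[u ->] /zpP[v ->]]; apply/zpP.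
- by exists 1; rewrite rmorph1.
- by exists (u - v); rewrite rmorphB.
- by exists (u * v); rewrite rmorphM.
Qed.
HB.instance Definition _ := GRing.isSubringClosed.Build K zp zp_subring.

Lemma zp_tofrac z : z%:Qp \in zp.
Proof. by apply/zpP; exists z. Qed.

(** Bezout gives an inverse of c modulo every p^n; inverses modulo p^n being unique, they form a
    coherent sequence. *)
Lemma zp_invn c : coprime c p -> (c%:R)^-1 \in zp.
Proof.
move=> cp; have c0 : (0 < c)%N.
  by case: c cp => //; rewrite /coprime gcd0n => /eqP p1; move: p_pr; rewrite p1.
have inv n : {b | (b * c = 1 %[mod p ^ n])%N}.
  exists (egcdn c (p ^ n)).1; case: egcdnP => // km kn -> _.
  have /eqP-> : coprime c (p ^ n) by rewrite coprimeXr.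
  by rewrite modnMDl.
pose f n := sval (inv n).
have fP n : (f n.+1 = f n %[mod p ^ n])%N.
  have e1 : (f n.+1 * c = 1 %[mod p ^ n])%N.
    by rewrite -(modn_dvdm _ (dvdn_exp2l p (leqnSn n))) (svalP (inv n.+1)) modn_dvdm ?dvdn_exp2l.
  by rewrite -[f n in RHS]muln1 -modnMmr -e1 modnMmr mulnCA -modnMmr (svalP (inv n)) modnMmr muln1.
apply/zpP; exists (padic_of fP).
have cK : c%:R != 0 :> K by rewrite -(ltn_predK c0) padic_char0.
apply: (mulIf cK); rewrite mulVf //.
rewrite -(rmorph_nat (@FracField.tofrac (padic_int p))) -rmorphM.
rewrite -[LHS](rmorph1 (@FracField.tofrac (padic_int p))).
congr (_ %:Qp); apply: padic_int_ext => n.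
by rewrite padic_intME padic_natE /= modnMm (svalP (inv n)).
Qed.

Local Notation pdvd_zp := (pdvd p zp).

Lemma padic_congrE M x y : padic_congr M x y <-> pdvd_zp M (x - y).
Proof.
have pM := pX_neq0 qp_of_rat p_pr M.
split=> [[z xy]|/zpP[z xy]]; first by rewrite /pdvd xy mulrAC divff // mul1r zp_tofrac.
by exists z; rewrite -xy mulrCA divff // mulr1.
Qed.

(** The quotient has components z(n+M) / p^M: M further digits are read before dividing. *)
Lemma padic_divp z M : z M = 0%N -> exists w, z = p%:R ^+ M * w.
Proof.
move=> zM; have pM : (p ^ M %| z M)%N by rewrite zM.
have pX m : (0 < p ^ m)%N by rewrite expn_gt0 prime_gt0.
have dz n : (p ^ M %| z (n + M)%N)%N.
  by rewrite /dvdn padic_coherent_le ?leq_addl // zM.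
pose f n := (z (n + M) %/ p ^ M)%N.
have fP n : (f n.+1 = f n %[mod p ^ n])%N.
  apply/eqP; rewrite -(eqn_pmul2r (pX M)) !muln_modl //.
  rewrite /f !divnK // -expnD addSn (padic_coherent z) padic_res_mod //.
exists (padic_of fP); apply: padic_int_ext => n.
rewrite -natrX padic_intME padic_natE /= modnMm /f mulnC divnK //.
by rewrite padic_coherent_le ?leq_addr.
Qed.

Lemma pdvd_tofrac M u v : pdvd_zp M (u%:Qp - v%:Qp) = (u M == v M).
Proof.
have pM := pX_neq0 qp_of_rat p_pr M.
apply/idP/eqP => [/padic_congrE[z]|uv].
  rewrite -(rmorph_nat (@FracField.tofrac (padic_int p))) -rmorphXn -rmorphM /=.
  move/(canRL (subrK _)); rewrite -rmorphD => /eqP; rewrite tofrac_eq => /eqP->.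
  by rewrite -natrX padic_intDE padic_intME padic_natE modnn mul0n mod0n add0n padic_res_mod.
have [|w uvE] := @padic_divp (u - v) M.
  rewrite padic_intDE /= uv modnDmr subnKC ?modnn //.
  by rewrite -padic_res_mod ltnW // ltn_mod expn_gt0 prime_gt0.
apply/padic_congrE; exists w.
by rewrite -rmorphB uvE rmorphM rmorphXn rmorph_nat.
Qed.

Lemma pdvd_separated x : (forall M, pdvd_zp M x) -> x = 0.
Proof.
move=> xM; have /zpP[z xz] : x \in zp by have := xM 0; rewrite pdvd_zero.
rewrite xz -[RHS](rmorph0 (@FracField.tofrac (padic_int p))); congr (_ %:Qp).
apply: padic_int_ext => M; apply/eqP; rewrite -pdvd_tofrac rmorph0 subr0 -xz.
exact: xM.
Qed.

(** The terms may lie outside Z_p, but their differences from x(N 0) are eventually integral. The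
    limit of these differences is built diagonally, its component M being their eventual component
    M. *)
Lemma padic_complete (x : nat -> K) :
  (forall M, exists N, forall n m, (N <= n)%N -> (N <= m)%N -> pdvd_zp M (x n - x m)) ->
  exists l, forall M, exists N, forall n, (N <= n)%N -> pdvd_zp M (x n - l).
Proof.
move=> /choice[N NP].
(* The sum serves as a common upper bound of N 0, ..., N M. *)
pose a M := (\sum_(i < M.+1) N i)%N.
have aN M i : (i <= M)%N -> (N i <= a M)%N.
  by rewrite -ltnS => iM; rewrite /a (bigD1 (Ordinal iM)) //= leq_addr.
have /choice[z zE] n : exists z, (N 0 <= n)%N -> x n - x (N 0%N) = z%:Qp.
  have [Nn|_] := leqP (N 0%N) n; last by exists 0.
  have := NP 0%N n (N 0%N) Nn (leqnn _); rewrite pdvd_zero => /zpP[z xz].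
  by exists z.
have zP M n m : (N 0 <= n)%N -> (N 0 <= m)%N -> (N M <= n)%N -> (N M <= m)%N ->
    z n M = z m M.
  move=> n0 m0 nM mM; apply/eqP; rewrite -pdvd_tofrac -!zE //.
  have -> : x n - x (N 0%N) - (x m - x (N 0%N)) = x n - x m by ring.
  exact: NP.
pose f M := z (a M) M.
have fP M : (f M.+1 = f M %[mod p ^ M])%N.
  rewrite /f padic_coherent padic_res_mod; apply: zP; apply: aN; lia.
exists (x (N 0%N) + (padic_of fP)%:Qp) => M; exists (a M) => n an.
have n0 : (N 0 <= n)%N by apply: leq_trans an; apply: aN.
rewrite opprD addrA zE // pdvd_tofrac /= /f padic_res_mod; apply/eqP.
by apply: zP => //; try apply: leq_trans an; apply: aN.
Qed.

(** The value at t is the limit of g along the residues t(n), natural numbers that converge to t;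
    uniform continuity makes this sequence Cauchy. *)
Lemma padic_cont_extend (g : nat -> K) : padic_cont p zp g ->
  exists F : padic_int p -> K, (forall m, F m%:R = g m) /\
    forall M, exists N, forall t u, t N = u N -> pdvd_zp M (F t - F u).
Proof.
move=> [gO gc].
have /choice[F FP] t : exists l, forall M, exists N, forall n, (N <= n)%N ->
    pdvd_zp M (g (t n) - l).
  apply: padic_complete => M; have [N NP] := gc M; exists N => n m Nn Nm.
  by apply: NP; rewrite !padic_coherent_le.
exists F; split=> [m|M].
  apply/eqP; rewrite -subr_eq0; apply/eqP/pdvd_separated => M.
  have [[N NP] [N' NP']] := (FP m%:R M, gc M).
  have /(_ (maxn N N'))/(_ (leq_maxl _ _)) := NP; rewrite padic_natE => d1.
  have d2 : pdvd_zp M (g (m %% p ^ maxn N N')%N - g m).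
    by apply: NP'; rewrite modn_dvdm // dvdn_exp2l // leq_maxr.
  have := pdvdB d2 d1; congr (pdvd _ _ _ _); ring.
have [N NP] := gc M; exists N => t u tu.
have [[N1 N1P] [N2 N2P]] := (FP t M, FP u M).
pose n := maxn N (maxn N1 N2).
have d1 : pdvd_zp M (g (t n) - F t) by apply: N1P; lia.
have d2 : pdvd_zp M (g (u n) - F u) by apply: N2P; lia.
have d3 : pdvd_zp M (g (t n) - g (u n)).
  by apply: NP; rewrite !padic_coherent_le // leq_maxl.
have := pdvdD (pdvdB d3 d1) d2; congr (pdvd _ _ _ _); ring.
Qed.

End PadicNumbers.

Arguments zp : clear implicits.

(** Conductor 1: the ones are values of the primitive character and powers of the conductor, x is
    p^(n-1) and b is B_n(1). *)
Lemma euler_factor_eq (F : fieldType) (N q x b : F) : N != 0 -> q != 0 ->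
  - (1 - 1 * x) * (1 / 1 * (1 * b)) / N = - (q * (1 - x) * b / (N * q)).
Proof. by move=> N0 q0; field; rewrite ?oner_neq0 ?N0 ?q0. Qed.

(** Conductor p: the zeros are the values of the character at p, in the Euler factor and in the last
    term of the sum. *)
Lemma nontrivial_factor_eq (F : fieldType) (N q Q s x b : F) : N != 0 -> q != 0 ->
  - (1 - 0 * x) * (Q / q * (s + 0 * b)) / N = - (Q * s / (N * q)).
Proof. by move=> N0 q0; field; rewrite ?N0 ?q0. Qed.

(** * Characters modulo p and their generalized Bernoulli numbers *)

Section PadicLFunction.
Variable p : prime_number.
Local Notation K := (padic p).

Let p_pr : prime p := Defs.primeP p.

Lemma coprime_ltp a : (0 < a < p)%N -> coprime a p.
Proof.
by case/andP=> a0 ap; rewrite coprime_sym prime_coprime // gtnNdvd.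
Qed.

Section ModulusP.
Variable psi : dirichlet K.
Hypothesis psi_p : dmod psi = p.

Lemma dval_modp a : psi (a %% p)%N = psi a.
Proof.
by have := dval_periodicM psi (a %/ p) (a %% p); rewrite psi_p addnC -divn_eq.
Qed.

(** Multiplication by c permutes the residues modulo p, so the sum equals psi(c) times itself. *)
Lemma dval_sum_eq0 c : coprime c p -> psi c != 1 -> \sum_(1 <= a < p) psi a = 0.
Proof.
move=> cp psi1; have p0 := prime_gt0 p_pr.
have psi0 : psi 0%N = 0.
  apply/eqP; rewrite -[_ == 0]negbK dval_neq0 psi_p /coprime gcd0n.
  by rewrite gtn_eqF // prime_gt1.
have -> : \sum_(1 <= a < p) psi a = \sum_(a < p) psi a.
  by rewrite -(big_mkord xpredT) big_ltn // psi0 add0r.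
pose h (a : 'I_p) : 'I_p := Ordinal (ltn_pmod (c * a) p0).
have h_inj : injective h.
  move=> a b /(congr1 val)/= e; apply: val_inj => /=.
  wlog ab : a b e / (a <= b)%N.
    by move=> IH; case/orP: (leq_total a b) => le; [exact: IH|exact/esym/IH].
  move/esym/eqP: e; rewrite eqn_mod_dvd ?leq_mul // -mulnBr Gauss_dvdr 1?coprime_sym //.
  by rewrite -eqn_mod_dvd // !modn_small // => /eqP.
have e : psi c * \sum_(a < p) psi a = \sum_(a < p) psi a.
  rewrite [RHS](reindex_inj h_inj) mulr_sumr; apply: eq_bigr => a _ /=.
  by rewrite dval_modp dvalM.
apply/eqP; have /eqP := e; rewrite -subr_eq0 -{2}[\sum_(_ < _) _]mul1r -mulrBl.
by rewrite mulf_eq0 subr_eq0 (negPf psi1).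
Qed.

Lemma conductor_modp : conductor psi = if dfactors psi 1 then 1%N else p.
Proof.
have dp : divisors p = [:: 1%N; prime_val p].
  apply: (irr_sorted_eq ltn_trans ltnn (sorted_divisors_ltn p)) => [|d] /=.
    by rewrite prime_gt1.
  rewrite -dvdn_divisors ?prime_gt0 // !inE; have /primeP[_ dP] := p_pr.
  by apply/idP/orP => [/dP/orP//|[/eqP->|/eqP->]]; rewrite ?dvd1n ?dvdnn.
rewrite /conductor psi_p dp /=.
have -> : dfactors psi p.
  apply/forallP=> a; apply/implyP => /andP[_ /eqP a1].
  rewrite -dval_modp a1 modn_small ?prime_gt1 //.
  have psi11 : psi 1%N != 0 by rewrite dval_neq0 coprime1n.
  by apply/eqP/(mulfI psi11); rewrite -dvalM mulr1.
by case: ifP.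
Qed.

Lemma dprim_modp_id a : dfactors psi 1 = false -> dprim psi a = psi a.
Proof.
move=> psi1; rewrite /dprim conductor_modp psi1.
case: ifP => [_|/negbT]; last by rewrite -psi_p -dval_neq0 negbK => /eqP->.
by rewrite -dval_modp addnC mulnC modnMDl dval_modp.
Qed.

Lemma dfactors1 a : dfactors psi 1 -> coprime a p -> psi a = 1.
Proof.
move=> /forallP psi1 ap; have ap' : (a %% p < dmod psi)%N.
  by rewrite psi_p ltn_pmod ?prime_gt0.
have := psi1 (Ordinal ap'); rewrite /= psi_p coprime_modl ap modn1 eqxx /=.
by rewrite dval_modp => /eqP.
Qed.

(** The search defining [dprim] succeeds because a or a + 1 is prime to p. The value is 1 also at
    multiples of p, which yields the Euler factor 1 - p^(n-1). *)
Lemma dprim_trivial a : dfactors psi 1 -> dprim psi a = 1.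
Proof.
move=> psi1; rewrite /dprim conductor_modp psi1 coprimen1; apply: dfactors1 => //.
rewrite psi_p mul1n; set P := (fun j => _); set s := iota 0 p.
have hasP : has P s.
  have [ap|ap] := boolP (coprime a p).
    by apply/hasP; exists 0%N; rewrite ?mem_iota ?prime_gt0 // /P muln0 addn0.
  apply/hasP; exists 1%N; first by rewrite mem_iota prime_gt1.
  rewrite /P muln1 coprime_sym prime_coprime // dvdn_addr; last first.
    by move: ap; rewrite coprime_sym prime_coprime // negbK.
  by rewrite dvdn1 gtn_eqF // prime_gt1.
have := nth_find 0%N hasP; rewrite nth_iota ?add0n /P ?mul1n //.
by move: hasP; rewrite has_find size_iota.
Qed.

(** One formula covers both cases. For trivial psi the conductor is 1, and the distribution relation
    converts the Euler factor times B_n(1) into a sum over 0 < a < p. Otherwise the conductor is p,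
    and psi(p) = 0 removes both the Euler factor and the term a = p. *)
Lemma gen_bernoulli_modp n : (0 < n)%N ->
  - (1 - dprim psi p * p%:R ^+ n.-1) * gen_bernoulli n psi / n%:R =
  - ((\sum_(1 <= a < p) psi a *
        \sum_(j < n.+1) 'C(n, j)%:R * qp_of_rat p (bernoulli j) * p%:R ^+ j * a%:R ^+ (n - j))
     / (n%:R * p%:R)).
Proof.
case: n => // n _; have p0 := pX_neq0 (@qp_of_rat p) p_pr 1; rewrite expr1 in p0.
have pg0 := prime_gt0 p_pr.
under eq_bigr => a _.
  rewrite (_ : \sum_(j < _) _ = p%:R ^+ n.+1 *
     qp_of_rat p (bernoulli_poly n.+1).[a%:R / p%:R]); last first.
    rewrite -(rmorph_nat (@qp_of_rat p)) -rmorphXn -rmorphM bernoulli_poly_scale //.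
    rewrite rmorph_sum; apply: eq_bigr => j _.
    by rewrite !rmorphM !rmorphXn !rmorph_nat.
  over.
rewrite /gen_bernoulli conductor_modp; have [psi1|/negbTE psi1] := boolP (dfactors psi 1).
  have -> : \sum_(1 <= a < p) psi a * (p%:R ^+ n.+1 *
      qp_of_rat p (bernoulli_poly n.+1).[a%:R / p%:R]) =
      qp_of_rat p (\sum_(1 <= a < p) p%:R ^+ n.+1 * (bernoulli_poly n.+1).[a%:R / p%:R]).
    rewrite rmorph_sum; apply: eq_big_nat => a ap.
    rewrite dfactors1 ?coprime_ltp // mul1r rmorphM rmorphXn rmorph_nat //.
  rewrite bernoulli_poly_mult1 // !rmorphM rmorphB (rmorph1 (qp_of_rat p)) rmorphXn !rmorph_nat /=.
  rewrite dprim_trivial // big_nat1 dprim_trivial // expr1n (divr1 (1%:R : rat)).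
  rewrite -[ratr _]/(qp_of_rat p (bernoulli_poly n.+1).[1]).
  exact: (euler_factor_eq _ _ (@padic_char0 p n) p0).
rewrite dprim_modp_id // (_ : psi p = 0); last first.
  by apply/eqP; rewrite -[_ == 0]negbK dval_neq0 psi_p /coprime gcdnn gtn_eqF // prime_gt1.
rewrite big_nat_recr //= dprim_modp_id // (_ : psi p = 0); last first.
  by apply/eqP; rewrite -[_ == 0]negbK dval_neq0 psi_p /coprime gcdnn gtn_eqF // prime_gt1.
rewrite (nontrivial_factor_eq _ _ _ _ (@padic_char0 p n) p0) mulr_sumr.
congr (- (_ / _)); apply: eq_bigr => a _; rewrite dprim_modp_id //.
exact: mulrCA.
Qed.

End ModulusP.

End PadicLFunction.

(** * Existence of the Kubota-Leopoldt function for omega^(1-k) and its value at k *)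

Section KubotaLeopoldtExistence.
Variable p : prime_number.
Local Notation K := (padic p).
Let p_pr : prime p := Defs.primeP p.

Definition teichK (a : nat) : K := (teich p a)%:Qp.

Lemma teich1 : teich p 1 = 1.
Proof. by apply: padic_int_ext => n; rewrite padic_int1E /= exp1n. Qed.

Lemma teichX a n : teich p (a ^ n) = teich p a ^+ n.
Proof.
elim: n => [|n IHn]; first by rewrite expn0 teich1 expr0.
by rewrite expnS teichM IHn exprS.
Qed.

Lemma teichK_neq0 a : (0 < a < p)%N -> teichK a != 0.
Proof.
by move=> /coprime_ltp; rewrite tofrac_eq0 teich_eq0 coprime_sym prime_coprime.
Qed.

Lemma teichK_exp_pred a : coprime a p -> teichK a ^+ p.-1 = 1.
Proof.
move=> ap; have a0 : teichK a != 0.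
  by rewrite tofrac_eq0 teich_eq0 -prime_coprime // coprime_sym.
apply: (mulIf a0); rewrite -exprSr prednK ?prime_gt0 // mul1r.
by rewrite -rmorphXn -teichX (teich_eq_mod (@fermat_little a p p_pr)).
Qed.

Lemma teichK_inv a : (0 < a < p)%N -> (teichK a)^-1 \in zp p.
Proof.
move=> ap; have p1 := prime_gt1 p_pr.
have : teichK a ^+ p.-2 * teichK a = 1.
  by rewrite -exprSr prednK ?teichK_exp_pred ?coprime_ltp //; lia.
move/(canRL (mulfK (teichK_neq0 ap))); rewrite mul1r => <-.
by rewrite rpredX ?zp_tofrac.
Qed.

Lemma teichK_modp a : (0 < a < p)%N -> pdvd p (zp p) 1 (a%:R / teichK a - 1).
Proof.
move=> ap; have a0 := teichK_neq0 ap.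
rewrite -[X in _ - X](divff a0) -mulrBl pdvdMr ?teichK_inv //.
rewrite -(rmorph_nat (@FracField.tofrac (padic_int p))) pdvd_tofrac.
by rewrite padic_natE teich_modp expn1.
Qed.

Variable k : nat.
Hypothesis k_gt1 : (1 < k)%N.

Let chi := teich_power p (1 - k%:Z).

Lemma chiE a : (0 < a < p)%N -> chi a = teichK a ^- k.-1.
Proof.
move=> ap /=; rewrite gtnNdvd //; try by case/andP: ap.
have -> : 1 - k%:Z = - (k.-1)%:Z by lia.
by rewrite -exprnN.
Qed.

Let psi n := dmul chi (teich_power p (- n%:Z)).

Lemma psi_dmod n : dmod (psi n) = p.
Proof. by rewrite /= /lcmn gcdnn mulnK ?prime_gt0. Qed.

Lemma psiE n a : (0 < a < p)%N -> psi n a = chi a * teichK a ^- n.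
Proof.
move=> ap; congr (_ * _) => /=; rewrite gtnNdvd //; try by case/andP: ap.
by rewrite -exprnN.
Qed.

Let val n := - (1 - dprim (psi n) p * p%:R ^+ n.-1) * gen_bernoulli n (psi n) / n%:R.

Lemma valE n : (0 < n)%N -> val n = padic_L_val (@qp_of_rat p) p chi teichK n.
Proof.
move=> n0; rewrite /val gen_bernoulli_modp ?psi_dmod // /padic_L_val.
by congr (- (_ / _)); apply: eq_big_nat => a ap; rewrite psiE.
Qed.

Hypothesis p_ge7 : (7 <= p)%N.
Hypothesis p_gt2k : (2 ^ k <= p)%N.

(** Modulo p the inverse of chi(2) is 2^(k-1), which lies strictly between 1 and p because 2^k <= p.
    Thus chi is nontrivial and its L-function has no pole. *)
Lemma chi2_neq1 : chi 2%N != 1.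
Proof.
have c2 : (0 < 2 < p)%N by lia.
rewrite chiE // invr_eq1 -rmorphXn -(rmorph1 (@FracField.tofrac (padic_int p))) tofrac_eq -teichX.
apply/eqP => /(congr1 (fun z : padic_int p => z 1%N)).
rewrite teich_modp padic_int1E expn1 modn_small; last first.
  by apply: leq_trans p_gt2k; rewrite ltn_exp2l //; lia.
rewrite modn_small ?prime_gt1 //.
have : (1 < 2 ^ k.-1)%N by rewrite -[1%N](expn0 2) ltn_exp2l //; lia.
by move=> + e; rewrite e.
Qed.

Lemma chi_sum0 : \sum_(1 <= a < p) chi a = 0.
Proof.
by apply: (@dval_sum_eq0 p chi _ 2 _ chi2_neq1) => //; apply: coprime_ltp; lia.
Qed.

Lemma chi_zp a : (0 < a < p)%N -> chi a \in zp p.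
Proof. by move=> ap; rewrite chiE // -exprVn rpredX // teichK_inv. Qed.

Lemma padic_L_exists : exists f, is_padic_L chi f.
Proof.
have [|F [FE Fc]] := @padic_cont_extend p (fun m => padic_L_val (@qp_of_rat p) p chi teichK m.+1).
  apply: padic_L_val_cont => //.
  - exact: zp_invn.
  - exact: chi_zp.
  - exact: chi_sum0.
  - exact: teichK_neq0.
  - exact: teichK_modp.
(* F interpolates the values at n = m + 1, and s = 1 - n corresponds to m = n - 1 = -s. *)
exists (fun s => F (- s)); split=> [s _ M|n n0 /=].
  have [N NP] := Fc M; exists N => t _ /padic_congrE; rewrite pdvd_tofrac => /eqP st.
  by apply/padic_congrE/NP; rewrite /= st.
rewrite -[RHS]/(val n) valE //.
have -> : - (1 - n%:R) = (n.-1)%:R :> padic_int p.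
  by rewrite opprB -[X in _ - X]/(1%:R) -natrB // subn1.
by rewrite FE prednK.
Qed.

(** The interpolation formula is used at 1 - n with n + k - 1 = (p-1) p^N and N large: then 1 - n is
    p-adically close to k, so continuity applies, and the powers of omega cancel. *)
Lemma padic_zeta_congr M : (6 + k + M.*2 <= p)%N ->
  padic_congr M (p%:R ^+ k * padic_zeta p k)
    (\sum_(k.-1 <= m < M) qp_of_rat p (zeta_coef k.-1 m) * p%:R ^+ m *
       \sum_(1 <= a < p) a%:R ^- m).
Proof.
move=> pkM; have [Lc Lval] : is_padic_L chi (padic_L chi).
  exact: (xgetPex _ padic_L_exists).
have dom s : padic_L_domain chi s.
  case=> chi1 _; move: chi2_neq1; rewrite chi1 ?eqxx //.
  by apply: coprime_ltp; lia.
have [N0 /(_ _ (dom _)) N0P] := Lc k%:R (dom _) M.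
(* Large enough both for the continuity modulus [N0] at k and for the hypothesis k - 1 + M < N of
   [zeta_approx]. *)
pose N := (N0 + k + M.+1)%N.
have NpN : (N < p ^ N)%N by rewrite ltn_expl //; lia.
have [n nk] : exists n, (n + k.-1 = p.-1 * p ^ N)%N.
  by exists (p.-1 * p ^ N - k.-1)%N; rewrite subnK //; nia.
have n0 : (0 < n)%N by nia.
have cong : padic_congr N0 (k%:R : padic_int p)%:Qp (1 - n%:R : padic_int p)%:Qp.
  apply/padic_congrE; rewrite -rmorphB.
  have -> : k%:R - (1 - n%:R) = (p.-1 * p ^ N)%:R :> padic_int p.
    rewrite -nk -[in k%:R](ltn_predK k_gt1) natrD -addn1 natrD; ring.
  rewrite rmorph_nat; apply: pdvd_nat; [exact: qp_of_rat|exact: p_pr|].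
  by rewrite dvdn_mull // dvdn_exp2l // /N -addnA leq_addr.
have := N0P _ cong; rewrite Lval // -/(val n) valE // => /padic_congrE d1.
apply/padic_congrE.
have d2 : pdvd p (zp p) M (p%:R ^+ k * padic_L_val (@qp_of_rat p) p chi teichK n -
    \sum_(k.-1 <= m < M) qp_of_rat p (zeta_coef k.-1 m) * p%:R ^+ m *
       \sum_(1 <= a < p) a%:R ^- m).
  (* The twist chi(a) omega(a)^(-n) is omega(a) to the power -(n + k - 1), a multiple of p - 1,
     hence equal to 1. *)
  rewrite /padic_L_val (eq_big_nat _ _ (F2 := fun a => \sum_(j < n.+1) 'C(n, j)%:R *
      qp_of_rat p (bernoulli j) * p%:R ^+ j * a%:R ^+ (n - j))); last first.
    move=> a ap; rewrite chiE // -invfM -exprD [(k.-1 + n)%N]addnC nk exprM.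
    by rewrite teichK_exp_pred ?coprime_ltp // expr1n invr1 mul1r.
  rewrite -[in p%:R ^+ k](ltn_predK k_gt1).
  apply: (@zeta_approx _ (@qp_of_rat p) p (zp p) p_pr (@zp_invn p) k.-1 M N n) => //.
  - lia.
  - lia.
  - by rewrite /N; lia.
  move=> a ap; have -> : a%:R ^+ p.-1 = (a%:R / teichK a) ^+ p.-1.
    by rewrite expr_div_n teichK_exp_pred ?divr1 // coprime_ltp.
  rewrite subrX1 pdvdMr ?teichK_modp // rpred_sum // => i _; rewrite rpredX //.
  by rewrite rpredM ?rpred_nat ?teichK_inv.
have d3 := pdvdMl (rpredX k (rpred_nat (zp p) p)) d1.
have := pdvdD d3 d2; congr (pdvd _ _ _ _); rewrite /padic_zeta; ring.
Qed.

End KubotaLeopoldtExistence.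

(** * Harmonic sums with one part and the asymptotic representation *)

Lemma mhs1 n m : mhs n [:: m] = \sum_(1 <= a < n.+1) a%:R ^- m.
Proof.
rewrite (big_nat_widenl 1 0) // big_mkord /mhs.
rewrite (reindex (fun i : 'I_n.+1 => [tuple i])) /=; last first.
  exists (fun t : 1.-tuple 'I_n.+1 => thead t) => [i _|t _]; first by rewrite theadE.
  by case/tupleP: t => x t; rewrite theadE [t]tuple0; apply: val_inj.
by apply: eq_big => [i|i _]; rewrite ?andbT // big_ord1.
Qed.

Definition zeta_rep_coef (k : nat) (s : seq nat) : rat :=
  if s is [:: m] then if (k <= m)%N then zeta_coef k m else 0 else 0.

(** The coefficients vanish outside the [[:: m]] with m >= k, and k > 0 makes each of these a
    composition; the duplicate-free list of compositions can thus be reduced to an interval of m. *)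
Lemma sum_zeta_rep_coef (R : nzRingType) k M (F : seq nat -> R) (G : rat -> R) :
  (0 < k)%N -> G 0 = 0 ->
  \sum_(s <- compositions_lt M) G (zeta_rep_coef k s) * F s =
  \sum_(k <= m < M) G (zeta_coef k m) * F [:: m].
Proof.
move=> k0 G0; pose L := [seq [:: m] | m <- index_iota k M].
rewrite (bigID (fun s => s \in L)) /= [X in _ + X]big1_seq ?addr0; last first.
  move=> [|m [|m' s]] /andP[sL]; rewrite /= ?G0 ?mul0r // mem_compositions_lt.
  case: ifP => [km|_]; rewrite ?G0 ?mul0r // /weight /= addn0 => /andP[_ mM].
  by case/mapP: sL; exists m; rewrite // mem_index_iota km.
rewrite -big_filter (perm_big L).
  rewrite big_map; apply: eq_big_nat => m /andP[km _].
  by rewrite /zeta_rep_coef km.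
apply: uniq_perm.
- exact/filter_uniq/uniq_compositions_lt.
- by rewrite map_inj_uniq ?iota_uniq // => x y [].
move=> s; rewrite mem_filter; apply: andb_idr => /mapP[m].
rewrite mem_index_iota => /andP[km mM] ->.
by rewrite mem_compositions_lt /= /weight /= addn0 mM !andbT (leq_trans k0).
Qed.

Theorem theorem6 (k : nat) (hk : (2 <= k)%N) :
  asymptotically_representable (fun p => p%:R ^+ k * padic_zeta p k).
Proof.
pose rep (n : nat) (p : prime_number) : padic p := \sum_(s <- compositions_lt n)
  ratr (zeta_rep_coef k.-1 s) * p%:R ^+ weight s * ratr (mhs p.-1 s).
have repE n (p : prime_number) : rep n p =
    \sum_(k.-1 <= m < n) qp_of_rat p (zeta_coef k.-1 m) * p%:R ^+ m *
       \sum_(1 <= a < p) a%:R ^- m.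
  rewrite /rep; under eq_bigr do rewrite -mulrA.
  rewrite (@sum_zeta_rep_coef _ k.-1 n
    (fun s => p%:R ^+ weight s * ratr (mhs p.-1 s)) (@qp_of_rat p)) ?rmorph0 //; last by lia.
  apply: eq_bigr => m _; rewrite mulrA /weight /= addn0 mhs1; congr (_ * _).
  rewrite -[LHS]/(qp_of_rat p _) rmorph_sum prednK ?prime_gt0 ?Defs.primeP //.
  by apply: eq_bigr => a _; rewrite fmorphV rmorphXn rmorph_nat.
have repP n (p : prime_number) : (2 ^ k + 6 + k + n.*2 < p)%N ->
    padic_congr n (p%:R ^+ k * padic_zeta p k) (rep n p).
  (* In the bound on p, 2^k makes omega^(1-k) nontrivial, and the rest serves the estimates modulo
     p^n. *)
  by move=> kp; rewrite repE; apply: padic_zeta_congr => //; lia.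
split; last first.
  exists (zeta_rep_coef k.-1) => n _.
  by exists (2 ^ k + 6 + k + n.*2)%N => p; apply: repP.
(* Integrality comes from the case n = 1: the approximating sum is empty since m starts at k - 1 >=
   1, so the family even lies in p Z_p. *)
exists (2 ^ k + 6 + k + 1.*2)%N => p /(repP 1%N)[z]; rewrite repE big_geq; last by lia.
rewrite subr0 => ->; exists (p%:R ^+ 1 * z).
by rewrite rmorphM rmorphXn rmorph_nat.
Qed.
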